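(* Let $G$ be a (finite simple) chordal graph with edge ideal $I(G)$. Then for every integer $s$ with $1\leq s\leq \operatorname{ht}(I(G))$, we have $$\operatorname{reg}(I(G)^{\{s\}})\leq s+\operatorname{ord-match}(G).$$
   Context: Let $\mathbb{K}$ be a field and let $G$ be a finite simple graph with vertex set $\{x_1,\ldots,x_n\}$; vertices are identified with the variables of $S=\mathbb{K}[x_1,\ldots,x_n]$. The edge ideal is $I(G)=(x_ix_j : x_ix_j\in E(G))\subseteq S$; its height $\operatorname{ht}(I(G))$ equals the smallest cardinality of a vertex cover of $G$. For a squarefree monomial ideal $I$ with irredundant primary decomposition $I=\mathfrak{p}_1\cap\cdots\cap\mathfrak{p}_r$ (each $\mathfrak{p}_i$ generated by variables), the $s$-th symbolic power ($s\ge 1$) is $I^{(s)}=\mathfrak{p}_1^s\cap\cdots\cap\mathfrak{p}_r^s$. The squarefree part of a monomial ideal is the ideal generated by all squarefree monomials in it; $I^{\{s\}}$ denotes the squarefree part of $I^{(s)}$. For a graded $S$-module $M$ with graded Betti numbers $\beta_{i,j}(M)$, $\operatorname{reg}(M)=\max\{j-i : \beta_{i,j}(M)\neq 0\}$ (here $I(G)^{\{s\}}$ is regarded as a graded $S$-module). A graph is chordal if it has no induced cycle of length at least four. A nonempty matching $M=\{a_ib_i : 1\leq i\leq r\}$ of $G$ (a set of pairwise disjoint edges) is an ordered matching if (1) $\{a_1,\ldots,a_r\}$ is a set of independent (pairwise non-adjacent) vertices of $G$, and (2) $a_ib_j\in E(G)$ implies $i\leq j$. $\operatorname{ord-match}(G)$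 is the maximum cardinality of an ordered matching of $G$. *)

(* Defs.v *)
From HB Require Import structures.
From mathcomp Require Import all_boot all_order all_algebra.
From mathcomp Require Import mpoly.

Set Implicit Arguments.
Unset Strict Implicit.
Unset Printing Implicit Defensive.

Import GRing.Theory.
Local Open Scope ring_scope.

(* A finite simple graph on the vertices x_0, ..., x_(n-1) is a symmetric     *)
(* irreflexive relation [e : rel 'I_n]; the vertex i is identified with the   *)
(* variable ['X_i] of S = {mpoly K[n]}.                                       *)

Section Graphs.
Variables (n : nat) (e : rel 'I_n).

Definition induced_cycle (k : nat) (c : 'I_k -> 'I_n) : Prop :=
  injective c /\
  forall i j : 'I_k, e (c i) (c j) = (j == ordS i) || (i == ordS j).

Definition chordal : Prop :=
  forall (k : nat) (c : 'I_k -> 'I_n), (4 <= k)%N -> ~ induced_cycle c.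

Definition vertex_cover (C : {set 'I_n}) : bool :=
  [forall x, forall y, e x y ==> (x \in C) || (y \in C)].

(* The height of the edge ideal, as the smallest size of a vertex cover.      *)
Definition edge_ideal_height : nat :=
  #|[arg min_(C < [set: 'I_n] | vertex_cover C) #|C|]|.

Definition ordered_matching (r : nat) (a b : {ffun 'I_r -> 'I_n}) : bool :=
  [&& (0 < r)%N,
      [forall i, e (a i) (b i)],
      [forall i, forall j,
         (i != j) ==> [disjoint [set a i; b i] & [set a j; b j]]],
      [forall i, forall j, ~~ e (a i) (a j)]
    & [forall i : 'I_r, forall j : 'I_r, e (a i) (b j) ==> (i <= j)%N]].

(* The bound r <= n loses nothing, since a matching of size r has 2r          *)
(* distinct vertices. A graph without edges has [ord_match = 0].              *)
Definition ord_match : nat :=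
  \max_(r < n.+1 |
    [exists a : {ffun 'I_r -> 'I_n}, exists b, ordered_matching a b]) r.

End Graphs.

Section Ideals.
Variables (K : fieldType) (n : nat).
Local Notation S := {mpoly K[n]}.
Implicit Types (I : S -> Prop) (A : {set 'I_n}) (P : {set {set 'I_n}}).

Definition ideal_gen (X : S -> Prop) : S -> Prop := fun f =>
  exists (r : nat) (g h : 'I_r -> S),
    (forall k, X (h k)) /\ f = \sum_(k < r) g k * h k.

Definition ideal_pow I (s : nat) : S -> Prop :=
  ideal_gen (fun f =>
    exists h : 'I_s -> S, (forall k, I (h k)) /\ f = \prod_(k < s) h k).

Definition edge_ideal (e : rel 'I_n) : S -> Prop :=
  ideal_gen (fun f => exists i j, e i j /\ f = 'X_i * 'X_j).

Definition var_ideal A : S -> Prop :=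
  ideal_gen (fun f => exists2 i, i \in A & f = 'X_i).

(* I is the intersection of the primes generated by the sets of variables     *)
(* in P.                                                                      *)
Definition decomposition I P : Prop :=
  forall f, I f <-> (forall A, A \in P -> var_ideal A f).

Definition irredundant_decomposition I P : Prop :=
  decomposition I P /\ forall A, A \in P -> ~ decomposition I (P :\ A).

(* A squarefree monomial ideal has exactly one irredundant decomposition P.   *)
Definition symbolic_power I (s : nat) : S -> Prop := fun f =>
  exists2 P, irredundant_decomposition I P
           & forall A, A \in P -> ideal_pow (var_ideal A) s f.

Definition squarefree_monomial (m : 'X_{1..n}) : Prop :=
  forall i, (m i <= 1)%N.

Definition squarefree_part I : S -> Prop :=
  ideal_gen (fun f =>
    exists m, [/\ squarefree_monomial m, f = 'X_[m] & I f]).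

(* Minimal graded free resolutions of a homogeneous ideal I,                  *)
(*    ... -> F_2 -> F_1 -> F_0 -> I -> 0   with   F_i = (+)_k S(- shift i k), *)
(* where the elements of F_i = S^(rank i) are row vectors and the maps act by *)
(* right multiplication. The two degree conditions say that the maps are      *)
(* homogeneous of degree 0, and [res_minimal] that the image of F_(i+1) lies  *)
(* in (x_0, ..., x_(n-1)) F_i.                                                *)
Record min_graded_free_resolution I := MinGradedFreeResolution {
  res_rank : nat -> nat;
  res_shift : forall i, 'I_(res_rank i) -> nat;
  res_aug : 'cV[S]_(res_rank 0);
  res_diff : forall i, 'M[S]_(res_rank i.+1, res_rank i);
  res_aug_homog : forall k m,
    m \in msupp (res_aug k 0) -> mdeg m = res_shift k;
  res_diff_homog : forall i k l m,
    m \in msupp (res_diff i k l) ->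
    (mdeg m + res_shift l)%N = res_shift k;
  res_aug_image : forall f,
    I f <-> exists v : 'rV[S]_(res_rank 0), f = (v *m res_aug) 0 0;
  res_exact0 : forall v : 'rV[S]_(res_rank 0),
    v *m res_aug = 0 <-> exists w, v = w *m res_diff 0;
  res_exactS : forall i (v : 'rV[S]_(res_rank i.+1)),
    v *m res_diff i = 0 <-> exists w, v = w *m res_diff i.+1;
  res_minimal : forall i k l, (res_diff i k l)@_0 = 0
}.

Definition betti I (F : min_graded_free_resolution I) (i j : nat) : nat :=
  #|[set k : 'I_(res_rank F i) | res_shift k == j]|.

(* [is_regularity I r] says that reg(I) = r. Minimal graded free resolutions  *)
(* are unique up to isomorphism, so the choice of F is immaterial.            *)
Definition is_regularity I (r : int) : Prop :=
  exists F : min_graded_free_resolution I,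
    (exists i j, betti F i j <> 0%N /\ r = j%:Z - i%:Z) /\
    (forall i j, betti F i j <> 0%N -> j%:Z - i%:Z <= r).

End Ideals.

Arguments edge_ideal K {n} e _.

(* Main.v *)
(* The ideal I(G)^{s} is spanned by the monomials m such that every vertex    *)
(* cover of the subgraph induced on the support of m has at least s elements. *)
(* Its regularity is read off the Koszul homology of the ideal, to which a    *)
(* minimal resolution is compared through the double complex of both. For a   *)
(* squarefree monomial ideal J and a variable x, J = J' + x (J : x), where J' *)
(* is spanned by the monomials whose x-free part is in J, and therefore       *)
(* reg J <= max (reg J', reg (J : x) + 1).                                    *)
(* Let x be a simplicial vertex with closed neighbourhood N[x]. If y is a     *)
(* neighbour of x, some minimum vertex cover of a subgraph containing x and y *)
(* contains y, so taking the colon of the ideal of (G, s) by x y amounts to   *)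
(* taking the colon of the ideal of (G - y, s - 1) by x. Removing the         *)
(* neighbours of x one by one bounds the regularity of the colon by x by      *)
(* s + ord-match (G - N[x]), while ord-match (G - N[x]) < ord-match G because *)
(* the edge x y extends every ordered matching of G - N[x].                   *)

Require Import Defs.
From HB Require Import structures.
From mathcomp Require Import all_boot all_order all_algebra.
From mathcomp Require Import mpoly.
From mathcomp Require Import zify.
From Stdlib Require Import Classical.

Set Implicit Arguments.
Unset Strict Implicit.
Unset Printing Implicit Defensive.

Import GRing.Theory.
Local Open Scope ring_scope.

(** * Monomial supports *)

(** A monomial lies in I(G)^{s} exactly when the subgraph on its support has cover number at least s
    ([squarefree_symbolicP]), so every ideal of the induction is given by a condition [N] on
    supports. Splitting along a variable ([reg_le_split]) costs one unit on the colon ideal. For a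
    simplicial x this unit is paid by the drop of the ordered matching number from G to G - N[x]
    ([ord_match_induced_step]); for a neighbour y of x, by the drop from s to s - 1
    ([cover_ge_simplicial]). Hence the inductions [reg_le_simplicial] and [reg_le_chordal] close,
    and Dirac's theorem [exists_simplicial] supplies x. These bounds concern Koszul homology.
    [betti_reg_le] transfers them to Betti numbers: a basis vector of F_i of too large degree would
    be a Koszul boundary modulo the image of the next differential, and so would have all its
    entries in the maximal ideal. *)

Section MonomialSupport.
Variables (K : fieldType) (n : nat).
Local Notation S := {mpoly K[n]}.
Implicit Types (P Q : pred 'X_{1..n}) (p q : S) (i : 'I_n).

Definition msupp_in P p : Prop := forall m, p@_m != 0 -> P m.

Definition mrestr P p : S := \sum_(m <- msupp p | P m) p@_m *: 'X_[m].

Definition mdivX i p : S :=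
  \sum_(m <- msupp p | m i != 0%N) p@_m *: 'X_[m - U_(i)].

Lemma mcoeff_mrestr P p m : (mrestr P p)@_m = if P m then p@_m else 0.
Proof.
rewrite /mrestr raddf_sum /=.
under eq_bigr do rewrite mcoeffZ mcoeffX.
have [mp|mp] := boolP (m \in msupp p); last first.
  rewrite (memN_msupp_eq0 mp) if_same big_seq_cond big1 // => m' /andP[m'p _].
  have -> : (m' == m) = false by apply: contraNF mp => /eqP <-.
  by rewrite mulr0.
rewrite -big_filter; case: ifP => Pm.
  rewrite (bigD1_seq m) ?mem_filter ?Pm ?filter_uniq ?msupp_uniq //=.
  rewrite eqxx mulr1 big1 ?addr0 // => m' ne.
  by rewrite (negbTE ne) mulr0.
rewrite big_filter big1 // => m' Pm'.
have -> : (m' == m) = false by apply: contraFF Pm => /eqP <-.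
by rewrite mulr0.
Qed.

Lemma mcoeff_mulX i p m :
  ('X_i * p)@_m = if m i == 0%N then 0 else p@_(m - U_(i)).
Proof.
case: ifP => mi.
  apply: memN_msupp_eq0; apply/negP; rewrite mulrC (perm_mem (msuppMX _ _)).
  case/mapP => m' _ E; move: mi; rewrite {}E mnmDE mnm1E eqxx /=.
  by lia.
have Em : m = (U_(i) + (m - U_(i)))%MM.
  by apply/mnmP => j; rewrite mnmDE mnmBE mnm1E; case: eqP => [<-|] /=; lia.
by rewrite mulrC {1}Em mcoeffMX.
Qed.

Lemma mulXI i p q : 'X_i * p = 'X_i * q -> p = q.
Proof.
rewrite ['X_i * p]mulrC ['X_i * q]mulrC => E; apply/mpolyP => m.
by have := congr1 (mcoeff (U_(i) + m)) E; rewrite !mcoeffMX.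
Qed.

Lemma mcoeff_mdivX i p m : (mdivX i p)@_m = p@_(m + U_(i)).
Proof.
rewrite /mdivX raddf_sum /=.
have -> : p@_(m + U_(i)) = (mrestr (fun m => m i != 0%N) p)@_(m + U_(i)).
  by rewrite mcoeff_mrestr mnmDE mnm1E eqxx addn1.
rewrite /mrestr raddf_sum /=; apply: eq_bigr => m' m'i.
rewrite !mcoeffZ !mcoeffX; congr (_ * (nat_of_bool _)%:R).
apply/eqP/eqP => [<-|->]; apply/mnmP => j;
  by rewrite !(mnmBE,mnmDE,mnm1E,mnmBE); case: eqP => [<-|] /=; lia.
Qed.

Lemma mdivX_eq i p : p = 'X_i * mdivX i p + mrestr (fun m => m i == 0%N) p.
Proof.
apply/mpolyP => m; rewrite mcoeffD mcoeff_mulX mcoeff_mrestr mcoeff_mdivX.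
case: eqP => mi; rewrite ?add0r ?addr0 //; congr (_@__); apply/mnmP => j.
by rewrite mnmDE mnmBE mnm1E; case: eqP => [<-|] /=; lia.
Qed.

Lemma msupp_inW P Q p : (forall m, P m -> Q m) -> msupp_in P p -> msupp_in Q p.
Proof. by move=> PQ Pp m /Pp/PQ. Qed.

Lemma msupp_in0 P : msupp_in P 0.
Proof. by move=> m; rewrite mcoeff0 eqxx. Qed.

Lemma msupp_inD P p q : msupp_in P p -> msupp_in P q -> msupp_in P (p + q).
Proof.
move=> Pp Pq m; rewrite mcoeffD.
have [->|/Pp //] := eqVneq p@_m 0; rewrite add0r; exact: Pq.
Qed.

Lemma msupp_inN P p : msupp_in P p -> msupp_in P (- p).
Proof. by move=> Pp m; rewrite mcoeffN oppr_eq0; apply: Pp. Qed.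

Lemma msupp_in_sum P (I : Type) (r : seq I) (F : I -> S) :
  (forall k, msupp_in P (F k)) -> msupp_in P (\sum_(k <- r) F k).
Proof.
move=> PF; elim/big_ind: _ => //; [exact: msupp_in0|exact: msupp_inD].
Qed.

Lemma msupp_inM P Q p q :
  (forall m m', P m -> Q (m' + m)%MM) -> msupp_in P p -> msupp_in Q (q * p).
Proof.
move=> PQ Pp m; rewrite -mcoeff_msupp => /msuppM_le/allpairsP[[m1 m2] /= [_]].
by rewrite mcoeff_msupp => /Pp Pm ->; apply: PQ.
Qed.

Lemma msupp_inX P Q i p :
  (forall m, P m -> Q (m + U_(i))%MM) -> msupp_in P p -> msupp_in Q ('X_i * p).
Proof.
move=> PQ Pp m; rewrite mcoeff_mulX.
case: ifP => [_|/negbT mi]; first by rewrite eqxx.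
move/Pp/PQ; congr (Q _); apply/mnmP => j.
by rewrite mnmDE mnmBE mnm1E; case: eqP => [<-|] /=; lia.
Qed.

End MonomialSupport.

(** * The Koszul complex *)

Section KoszulChains.
Variables (K : fieldType) (n : nat).
Local Notation S := {mpoly K[n]}.

(* The Koszul complex, of all homological degrees at once, on the variables   *)
(* of [l] with coefficients in V. It is the mapping cone of multiplication by *)
(* the first variable of [l] on the Koszul complex of the others.             *)
Fixpoint kos (V : lmodType S) (l : seq 'I_n) : lmodType S :=
  if l is _ :: l' then ((kos V l' * kos V l')%type : lmodType S) else V.

(** The pair (a, b) stands for a + e_i b, where e_i is the exterior generator of the first variable;
    the sign comes from moving the differential past e_i. *)
Fixpoint kd (V : lmodType S) (l : seq 'I_n) : kos V l -> kos V l :=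
  match l with
  | [::] => fun=> 0
  | i :: l' => fun c : kos V l' * kos V l' =>
      (kd c.1 + 'X_i *: c.2, - kd c.2)
  end.

Fixpoint kmap (V W : lmodType S) (f : V -> W) (l : seq 'I_n) :
    kos V l -> kos W l :=
  match l with
  | [::] => f
  | i :: l' => fun c : kos V l' * kos V l' => (kmap f c.1, kmap f c.2)
  end.

Fixpoint kall (V : lmodType S) (P : V -> Prop) (l : seq 'I_n) :
    kos V l -> Prop :=
  match l with
  | [::] => P
  | i :: l' => fun c : kos V l' * kos V l' => kall P c.1 /\ kall P c.2
  end.

(** The component of exterior degree 0, the only place where the Koszul homology of a free module
    survives. *)
Fixpoint ktop (V : lmodType S) (l : seq 'I_n) : kos V l -> V :=
  match l with
  | [::] => id
  | i :: l' => fun c : kos V l' * kos V l' => ktop c.1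
  end.

Fixpoint kinj (V : lmodType S) (l : seq 'I_n) (v : V) : kos V l :=
  match l with
  | [::] => v
  | i :: l' => (kinj l' v, 0)
  end.

Implicit Types (V W : lmodType S) (l : seq 'I_n).

Lemma kdD V l : {morph @kd V l : a b / a + b}.
Proof.
elim: l => [|i l IH] a b /=; first by rewrite addr0.
by rewrite !IH scalerDr opprD; congr pair; rewrite addrACA.
Qed.

Lemma kdZ V l (x : S) : {morph @kd V l : a / x *: a}.
Proof.
elim: l => [|i l IH] a /=; first by rewrite scaler0.
rewrite !IH; congr pair; last by rewrite scalerN.
by rewrite scalerDr !scalerA mulrC.
Qed.

Lemma kdN V l : {morph @kd V l : a / - a}.
Proof. by move=> a; rewrite -scaleN1r kdZ scaleN1r. Qed.

Lemma kdB V l : {morph @kd V l : a b / a - b}.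
Proof. by move=> a b; rewrite kdD kdN. Qed.

Lemma kd0 V l : kd (0 : kos V l) = 0.
Proof. by have := @kdZ V l 0 0; rewrite !scale0r. Qed.

Lemma kdd V l (c : kos V l) : kd (kd c) = 0.
Proof.
elim: l c => [|i l IH] c //=.
by rewrite kdD kdZ kdN !IH add0r scalerN subrr !oppr0.
Qed.

Lemma kd_kinj V l (v : V) : kd (kinj l v) = 0.
Proof. by elim: l => //= i l ->; rewrite scaler0 kd0 oppr0 addr0. Qed.

Lemma ktop_kinj V l (v : V) : ktop (kinj l v) = v.
Proof. by elim: l. Qed.

Lemma ktopD V l : {morph @ktop V l : a b / a + b}.
Proof. by elim: l => //= i l IH a b; rewrite IH. Qed.

Lemma ktopB V l : {morph @ktop V l : a b / a - b}.
Proof. by elim: l => //= i l IH a b; rewrite IH. Qed.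

Lemma ktopZ V l (x : S) : {morph @ktop V l : a / x *: a}.
Proof. by elim: l => //= i l IH a; rewrite IH. Qed.

Lemma ktop_kmap V W (f : V -> W) l (c : kos V l) : ktop (kmap f c) = f (ktop c).
Proof. by elim: l c => //= i l IH c; rewrite IH. Qed.

Lemma kmap_id V (f : V -> V) l (c : kos V l) :
  kall (fun v => f v = v) c -> kmap f c = c.
Proof.
elim: l c => //= i l IH c [/IH -> /IH ->]; exact: esym (surjective_pairing c).
Qed.

Lemma kmap_comp V V' W (f : V -> V') (g : V' -> W) l (c : kos V l) :
  kmap g (kmap f c) = kmap (g \o f) c.
Proof. by elim: l c => //= i l IH [a b] /=; rewrite !IH. Qed.

Lemma kmapD V W (f : {additive V -> W}) l : {morph @kmap V W f l : a b / a + b}.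
Proof. by elim: l => [|i l IH] a b /=; rewrite ?raddfD // !IH. Qed.

Lemma kmapN V W (f : {additive V -> W}) l : {morph @kmap V W f l : a / - a}.
Proof. by elim: l => [|i l IH] a /=; rewrite ?raddfN // !IH. Qed.

(* Two maps, because projections to homogeneous components commute with       *)
(* the variables only up to a shift of degree.                                *)
Lemma kd_kmap V W (f g : {additive V -> W}) l (c : kos V l) :
  (forall i v, g ('X_i *: v) = 'X_i *: f v) ->
  kd (kmap f c) = kmap g (kd c).
Proof.
move=> fg; have gX i l' (a : kos V l') : kmap g ('X_i *: a) = 'X_i *: kmap f a.
  by elim: l' a => //= j l' IH a; rewrite !IH.
elim: l c => [|i l IH] c /=; first by rewrite raddf0.
by rewrite kmapD kmapN !IH gX.
Qed.

Lemma kd_kmap_linear V W (f : {linear V -> W}) l (c : kos V l) :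
  kd (kmap f c) = kmap f (kd c).
Proof. by apply: (kd_kmap (f := f) (g := f)) => i v; exact: linearZZ. Qed.

Lemma kallW V (P Q : V -> Prop) l (c : kos V l) :
  (forall v, P v -> Q v) -> kall P c -> kall Q c.
Proof. by move=> PQ; elim: l c => //= i l IH c []; auto. Qed.

Lemma kall_all V (P : V -> Prop) l (c : kos V l) : (forall v, P v) -> kall P c.
Proof. by move=> PQ; elim: l c => //=. Qed.

Lemma kall_ktop V (P : V -> Prop) l (c : kos V l) : kall P c -> P (ktop c).
Proof. by elim: l c => //= i l IH c [/IH]. Qed.

Lemma kall_kmap V W (f : V -> W) (P : W -> Prop) l (c : kos V l) :
  kall P (kmap f c) <-> kall (fun v => P (f v)) c.
Proof. by elim: l c => //= i l IH c; rewrite !IH. Qed.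

Lemma kall0 V (P : V -> Prop) l : P 0 -> kall P (0 : kos V l).
Proof. by move=> P0; elim: l => //=. Qed.

Lemma kallD V (P Q R : V -> Prop) l (a b : kos V l) :
  (forall u v, P u -> Q v -> R (u + v)) -> kall P a -> kall Q b ->
  kall R (a + b).
Proof.
move=> H; elim: l a b => [|i l IH] a b /=; first exact: H.
by case=> ? ? [? ?]; split; apply: IH.
Qed.

Lemma kallN V (P Q : V -> Prop) l (a : kos V l) :
  (forall u, P u -> Q (- u)) -> kall P a -> kall Q (- a).
Proof. by move=> H; elim: l a => [|i l IH] a /=; [exact: H|case; auto]. Qed.

Lemma kallZ V (P Q : V -> Prop) (x : S) l (a : kos V l) :
  (forall u, P u -> Q (x *: u)) -> kall P a -> kall Q (x *: a).
Proof. by move=> H; elim: l a => [|i l IH] a /=; [exact: H|case; auto]. Qed.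

Lemma kallZ_inv V (P Q : V -> Prop) (x : S) l (a : kos V l) :
  (forall u, Q (x *: u) -> P u) -> kall Q (x *: a) -> kall P a.
Proof. by move=> H; elim: l a => [|i l IH] a /=; [exact: H|case; auto]. Qed.

Lemma kall_kd V (P Q : V -> Prop) l (c : kos V l) :
  Q 0 -> (forall u v, Q u -> Q v -> Q (u + v)) -> (forall u, Q u -> Q (- u)) ->
  (forall i v, P v -> Q ('X_i *: v)) -> kall P c -> kall Q (kd c).
Proof.
move=> Q0 QD QN QX; elim: l c => //= i l IH c [Pa Pb]; split.
  apply: kallD (IH _ Pa) (kallZ _ Pb); [exact: QD|exact: QX].
exact: kallN (IH _ Pb).
Qed.

Lemma kmap_eq0 V W (f : V -> W) l (c : kos V l) :
  kmap f c = 0 <-> kall (fun v => f v = 0) c.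
Proof.
elim: l c => //= i l IH c; rewrite -!IH; split; first by case.
by case=> -> ->.
Qed.

Lemma kmap_lift V W (f : V -> W) (P : V -> Prop) l (c : kos W l) :
  kall (fun w => exists2 v, P v & w = f v) c ->
  exists2 b, kall P b & c = kmap f b.
Proof.
elim: l c => [|i l IH] c /=; first by case=> v; exists v.
case=> /IH[a Pa ea] /IH[b Pb eb]; exists (a, b) => //=.
by rewrite -ea -eb; case: c {ea eb}.
Qed.

Lemma kmap_split V (f g : V -> V) i l (c : kos V l) :
  (forall v, v = 'X_i *: g v + f v) -> c = 'X_i *: kmap g c + kmap f c.
Proof.
move=> E; elim: l c => [|j l IH] c /=; first exact: E.
by rewrite [LHS]surjective_pairing; congr pair; apply: IH.
Qed.

Lemma kscaleI V (x : S) l (a b : kos V l) :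
  (forall u v : V, x *: u = x *: v -> u = v) -> x *: a = x *: b -> a = b.
Proof.
move=> H; elim: l a b => [|i l IH] a b; first exact: H.
case: a => a a'; case: b => b b'.
by move=> E; congr pair; apply: IH; [case: E|case: E].
Qed.

(** The submodule of V generated by the multiples of the variables of [l], in a recursive form that
    follows the mapping cone. *)
Fixpoint in_varsmul V l (v : V) : Prop :=
  if l is i :: l' then exists g h, v = 'X_i *: g + h /\ in_varsmul l' h
  else v = 0.

Lemma ktop_kd V l (c : kos V l) : in_varsmul l (ktop (kd c)).
Proof.
elim: l c => //= i l IH c; exists (ktop c.2), (ktop (kd c.1)); split => //.
by rewrite ktopD ktopZ addrC.
Qed.

(** The first hypothesis is the regularity of the sequence of variables on V. Since all exterior
    degrees are treated together, the condition on [ktop c] removes the homology of degree 0. *)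
Lemma kd_exact V l (c : kos V l) :
  (forall i l' (v : V), uniq (i :: l') -> in_varsmul l' ('X_i *: v) ->
     in_varsmul l' v) ->
  uniq l -> kd c = 0 -> in_varsmul l (ktop c) -> exists y, c = kd y.
Proof.
move=> reg; elim: l c => [|i l IH] c /=; first by move=> _ _ c0; exists 0.
case: c => a b /= /andP[il ul] [Eab /eqP]; rewrite oppr_eq0 => /eqP Db.
have Da : kd (- a) = 'X_i *: b.
  by apply/eqP; rewrite kdN eq_sym -addr_eq0 addrC Eab.
have [|b' eb] := IH b ul Db.
  by apply: (reg i); rewrite /= ?il // -ktopZ -Da; apply: ktop_kd.
(* The correction by [kinj] is a cycle, so it leaves the differential alone; it is chosen so that
   the part of exterior degree 0 becomes h. *)
case=> g [h [Eg hl]]; case: (IH (a + 'X_i *: (b' - kinj l (g + ktop b'))) ul).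
- by rewrite kdD kdZ kdB kd_kinj subr0 -eb.
- rewrite ktopD ktopZ ktopB ktop_kinj Eg opprD addrCA subrr addr0 scalerN.
  by rewrite addrAC subrr add0r.
move=> a' ea; exists (a', kinj l (g + ktop b') - b') => /=.
rewrite kdB kd_kinj sub0r opprK -eb -ea; congr pair.
by rewrite -addrA -scalerDr addrA subrK subrr scaler0 addr0.
Qed.

End KoszulChains.

(** * Exactness of the Koszul complex of a free module *)

Section KoszulExactness.
Variables (K : fieldType) (n : nat).
Local Notation S := {mpoly K[n]}.

Definition mem_vars (l : seq 'I_n) : pred 'X_{1..n} :=
  fun m => has (fun i => m i != 0%N) l.

Lemma mem_vars_enum m : mem_vars (enum 'I_n) m = (m != 0%MM).
Proof.
apply/hasP/idP => [[i _ mi]|/eqP m0].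
  by apply: contraNneq mi => ->; rewrite mnm0E.
have [i mi] : exists i, m i != 0%N.
  apply/existsP; apply: contra_notT m0; rewrite negb_exists => /forallP H.
  by apply/mnmP => i; rewrite mnm0E; apply/eqP/negPn/H.
by exists i; rewrite // mem_enum.
Qed.

Lemma msupp_in_varsmulX i l (f : S) :
  i \notin l -> msupp_in (mem_vars l) ('X_i * f) -> msupp_in (mem_vars l) f.
Proof.
move=> il H m fm; have := H (m + U_(i))%MM.
rewrite addmC mulrC mcoeffMX => /(_ fm) /hasP[j jl].
rewrite mnmDE mnm1E; case: (i =P j) => [E|_] jm; first by rewrite E jl in il.
by apply/hasP; exists j.
Qed.

Lemma in_varsmul_row r l (v : 'rV[S]_r) :
  in_varsmul l v <-> forall t, msupp_in (mem_vars l) (v 0 t).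
Proof.
elim: l v => [|i l IH] v /=.
  split=> [-> t|H]; first by rewrite mxE; apply: msupp_in0.
  apply/rowP => t; rewrite mxE; apply/mpolyP => m; rewrite mcoeff0.
  by apply/eqP/negP => /negP /H.
split=> [[g [h [-> /IH Hh]]] t|H].
  rewrite !mxE; apply: msupp_inD; last first.
    by apply: msupp_inW (Hh t) => m /= ml; apply/orP; right.
  apply: (@msupp_inX _ _ predT) => // m _.
  by rewrite /mem_vars /= mnmDE mnm1E eqxx addn1.
exists (map_mx (mdivX i) v), (map_mx (mrestr (fun m => m i == 0%N)) v); split.
  by apply/rowP => t; rewrite !mxE -mdivX_eq.
apply/IH => t m; rewrite !mxE mcoeff_mrestr.
case: ifP => mi; last by rewrite eqxx.
by move/H; rewrite /mem_vars /= mi.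
Qed.

Lemma kd_exact_row r (c : kos 'rV[S]_r (enum 'I_n)) :
  kd c = 0 -> (forall t, (ktop c 0 t)@_0 = 0) -> exists y, c = kd y.
Proof.
move=> Dc H; apply: kd_exact => //.
- move=> i l v /= /andP[il _] /in_varsmul_row Hv; apply/in_varsmul_row => t.
  by apply: (msupp_in_varsmulX il); have := Hv t; rewrite !mxE.
- exact: enum_uniq.
- apply/in_varsmul_row => t m; rewrite mem_vars_enum.
  by apply: contraNneq => ->; rewrite H.
Qed.

End KoszulExactness.

(** * Regularity through Koszul homology *)

Section Regularity.
Variables (K : fieldType) (n : nat).
Local Notation S := {mpoly K[n]}.
Implicit Types (N : {set 'I_n} -> bool) (A B : {set 'I_n}) (x : 'I_n).

Definition mset (m : 'X_{1..n}) : {set 'I_n} := [set i | m i != 0%N].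

Lemma msetDU (m : 'X_{1..n}) x : mset (m + U_(x)) = x |: mset m.
Proof.
apply/setP => i; rewrite !inE mnmDE mnm1E [i == x]eq_sym.
by case: (x == i); rewrite /= ?addn1 ?addn0.
Qed.

Lemma mset_id (m : 'X_{1..n}) x : m x = 0%N -> mset m :\ x = mset m.
Proof.
move=> mx; apply/setP => i; rewrite !inE.
by case: eqP => [->|//]; rewrite mx.
Qed.

Definition ideal_at N w : S^o -> Prop :=
  msupp_in (fun m => N (mset m) && (mdeg m == w)).

(* The Koszul homology of the ideal spanned by the monomials m with           *)
(* N (mset m) vanishes in the degrees which the regularity bound d excludes:  *)
(* in homological degree i and internal degree j the coefficients of a chain  *)
(* have degree j - i, so i need not be recorded.                              *)
Definition reg_le N d : Prop :=
  forall w (z : kos S^o (enum 'I_n)), (d <= w)%N ->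
    kall (ideal_at N w.+1) z -> kd z = 0 ->
    exists2 y, kall (ideal_at N w) y & z = kd y.

Lemma ideal_at0 N w : ideal_at N w 0. Proof. exact: msupp_in0. Qed.

Lemma ideal_atW N N' w f :
  (forall A, N A -> N' A) -> ideal_at N w f -> ideal_at N' w f.
Proof. by move=> NN'; apply: msupp_inW => m /andP[/NN' -> ->]. Qed.

Lemma kall_atW N N' w (z : kos S^o (enum 'I_n)) :
  (forall A, N A -> N' A) -> kall (ideal_at N w) z -> kall (ideal_at N' w) z.
Proof. by move=> NN'; apply: kallW => f; apply: ideal_atW. Qed.

Lemma kall_atD N w (y z : kos S^o (enum 'I_n)) :
  kall (ideal_at N w) y -> kall (ideal_at N w) z -> kall (ideal_at N w) (y + z).
Proof. by apply: kallD => u v; apply: msupp_inD. Qed.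

Lemma kall_atN N w (z : kos S^o (enum 'I_n)) :
  kall (ideal_at N w) z -> kall (ideal_at N w) (- z).
Proof. by apply: kallN => u; apply: msupp_inN. Qed.

Lemma ideal_atX N N' w x (f : S) :
  (forall A, N A -> N' (x |: A)) -> ideal_at N w f ->
  ideal_at N' w.+1 ('X_x * f).
Proof.
move=> NN'; apply: msupp_inX => m /andP[Nm /eqP wm].
by rewrite msetDU NN' // mdegD wm mdeg1 addn1 eqxx.
Qed.

Lemma kall_at_kd N w (z : kos S^o (enum 'I_n)) :
  {homo N : A B / A \subset B >-> A ==> B} ->
  kall (ideal_at N w) z -> kall (ideal_at N w.+1) (kd z).
Proof.
move=> monoN; apply: kall_kd.
- exact: ideal_at0.
- by move=> u v; apply: msupp_inD.
- by move=> u; apply: msupp_inN.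
- move=> i v; apply: ideal_atX => A; apply/implyP/monoN; exact: subsetUr.
Qed.

Lemma reg_leW N d d' : (d <= d')%N -> reg_le N d -> reg_le N d'.
Proof. by move=> dd' H w z /(leq_trans dd'); apply: H. Qed.

Lemma eq_reg_le N N' d : N =1 N' -> reg_le N d -> reg_le N' d.
Proof.
move=> E H w z dw Jz Dz; have [|y Jy ->] := H w z dw _ Dz.
  by apply: kall_atW Jz => A; rewrite E.
by exists y => //; apply: kall_atW Jy => A; rewrite E.
Qed.

Lemma reg_le_false N d : (forall A, N A = false) -> reg_le N d.
Proof.
move=> NF w z _ Jz _; exists 0; first exact/kall0/ideal_at0.
rewrite kd0 -[z](@kmap_id _ _ _ id); last exact: kall_all.
apply/kmap_eq0; apply: kallW Jz => f Jf.
apply/mpolyP => m; rewrite mcoeff0; apply/eqP/negP => /negP /Jf.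
by rewrite NF.
Qed.

(* 0 -> x J' (-1) -> J' + x L -> J -> 0, where J' and L are the ideals of the *)
(* first and the second hypothesis.                                           *)
Lemma reg_le_split N x d :
  {homo N : A B / A \subset B >-> A ==> B} ->
  reg_le (fun A => N (A :\ x)) d.+1 -> reg_le (fun A => N (x |: A)) d ->
  reg_le N d.+1.
Proof.
move=> monoN; set N' := fun A => N (A :\ x); set L := fun A => N (x |: A).
have subN A B : A \subset B -> N A -> N B by move/monoN/implyP.
have monoN' : {homo N' : A B / A \subset B >-> A ==> B}.
  by move=> A B AB; apply: monoN; apply: setSD.
move=> regN' regL [//|w] z dw Jz Dz.
pose z' := @kmap _ _ S^o S^o (mrestr (fun m => m x == 0%N)) _ z.
pose z2 := @kmap _ _ S^o S^o (mdivX x) _ z.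
have Ez : z = 'X_x *: z2 + z' by apply: kmap_split => f; apply: mdivX_eq.
have Jz' : kall (ideal_at N' w.+2) z'.
  apply/kall_kmap; apply: kallW Jz => f Jf m; rewrite mcoeff_mrestr.
  case: ifP => [/eqP mx /Jf|_]; last by rewrite eqxx.
  by rewrite /N' mset_id.
have Jz2 : kall (ideal_at L w.+1) z2.
  apply/kall_kmap; apply: kallW Jz => f Jf m; rewrite mcoeff_mdivX => /Jf.
  by rewrite /L msetDU mdegD mdeg1 addn1 eqSS.
(* [w1] represents the connecting homomorphism. It is a cycle of J', hence the boundary of some [u],
   and moving x [u] from one summand of [z] to the other makes both summands cycles. *)
pose w1 := - kd z2.
have Ew1 : 'X_x *: w1 = kd z'.
  by apply/eqP; rewrite eq_sym scalerN -addr_eq0 addrC -kdZ -kdD -Ez Dz.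
(* The condition [N'] ignores x, so it survives division by x. *)
have Jw1 : kall (ideal_at N' w.+2) w1.
  have : kall (ideal_at N' w.+3) ('X_x *: w1) by rewrite Ew1; apply: kall_at_kd.
  apply: kallZ_inv => f Jf m fm; have := Jf (U_(x) + m)%MM.
  have -> : ('X_x *: f) = f * 'X_x :> S by rewrite mulrC.
  rewrite mcoeffMX => /(_ fm); rewrite addmC msetDU mdegD mdeg1 addn1 eqSS.
  by rewrite /N' setDUl setDv set0U.
have [|u Ju Eu] := regN' w.+1 w1 dw Jw1.
  apply: (@kscaleI _ _ _ 'X_x); first by move=> u v; apply: mulXI.
  by rewrite -kdZ Ew1 kdd scaler0.
have N'L A : N' A -> L A.
  by apply: subN; apply: subset_trans (subsetDl _ _) (subsetUr _ _).
have [||p Jp Ep] := regN' w.+1 (z' - 'X_x *: u) dw.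
- apply: kall_atD Jz' _; apply: kall_atN; apply: kallZ Ju => f.
  apply: ideal_atX => A; apply: subN; apply: setSD; exact: subsetUr.
- by rewrite kdB kdZ -Eu -Ew1 subrr.
have [|||q Jq Eq] := regL w (z2 + u).
- by rewrite -ltnS.
- by apply: kall_atD Jz2 _; apply: kall_atW Ju.
- by rewrite kdD -Eu subrr.
exists (p + 'X_x *: q).
  apply: kall_atD; last by apply: kallZ Jq => f; apply: ideal_atX => A.
  by apply: kall_atW Jp => A; apply: subN; apply: subsetDl.
by rewrite kdD kdZ -Ep -Eq scalerDr {1}Ez addrC [X in _ = _ + X]addrC addrA subrK.
Qed.

End Regularity.

(** * Homogeneous components and graded exactness *)

Section GradedProjection.
Variables (K : fieldType) (n : nat).
Local Notation S := {mpoly K[n]}.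

Definition rproj r (sh : 'I_r -> nat) t (v : 'rV[S]_r) : 'rV[S]_r :=
  \row_k mrestr (fun m => (mdeg m + sh k)%N == t) (v 0 k).

Lemma rproj_is_zmod_morphism r (sh : 'I_r -> nat) t :
  zmod_morphism (rproj sh t).
Proof.
move=> u v; apply/rowP => k; rewrite !mxE; apply/mpolyP => m.
by rewrite mcoeffB !mcoeff_mrestr mcoeffB; case: ifP; rewrite ?subr0.
Qed.
HB.instance Definition _ r sh t :=
  GRing.isZmodMorphism.Build _ _ (@rproj r sh t) (rproj_is_zmod_morphism sh t).

Definition row_homog r (sh : 'I_r -> nat) t (v : 'rV[S]_r) : Prop :=
  forall k, msupp_in (fun m => (mdeg m + sh k)%N == t) (v 0 k).

Lemma rprojP r (sh : 'I_r -> nat) t v : row_homog sh t (rproj sh t v).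
Proof.
by move=> k m; rewrite mxE mcoeff_mrestr; case: ifP => //; rewrite eqxx.
Qed.

Lemma rproj_homog r (sh : 'I_r -> nat) t v :
  row_homog sh t v -> rproj sh t v = v.
Proof.
move=> hv; apply/rowP => k; apply/mpolyP => m; rewrite mxE mcoeff_mrestr.
by case: ifPn => // nm; apply/esym/eqP; apply: contraNT nm => /hv.
Qed.

Lemma rprojX r (sh : 'I_r -> nat) t i v :
  rproj sh t.+1 ('X_i *: v) = 'X_i *: rproj sh t v.
Proof.
apply/rowP => k; rewrite !mxE; apply/mpolyP => m.
rewrite mcoeff_mrestr !mcoeff_mulX mcoeff_mrestr.
have [_|mi] := eqVneq (m i) 0%N.
  by rewrite if_same.
suff -> : mdeg m = (mdeg (m - U_(i))).+1 by [].
rewrite -addn1 -(mdeg1 i) -mdegD; congr mdeg; apply/mnmP => j.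
by rewrite mnmDE mnmBE mnm1E; case: eqP => [<-|] /=; lia.
Qed.

(** A chain bounding [c] need not be homogeneous, but its component of degree t still bounds [c],
    because the Koszul differential raises the degree of coefficients by one. *)
Lemma kd_exact_homog r (sh : 'I_r -> nat) t (c : kos 'rV[S]_r (enum 'I_n)) :
  kall (row_homog sh t.+1) c -> kd c = 0 -> (forall k, (ktop c 0 k)@_0 = 0) ->
  exists2 y, kall (row_homog sh t) y & c = kd y.
Proof.
move=> hc Dc c0; have [y Ey] := kd_exact_row Dc c0.
exists (kmap (rproj sh t) y).
  by apply/kall_kmap; apply: kall_all; apply: rprojP.
rewrite (kd_kmap (g := rproj sh t.+1)); last by move=> *; apply: rprojX.
rewrite -Ey kmap_id //; apply: kallW hc => v; exact: rproj_homog.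
Qed.

Definition rowform r (A : 'cV[S]_r) (v : 'rV[S]_r) : S^o := (v *m A) 0 0.

Lemma rowform_is_linear r (A : 'cV[S]_r) : linear (rowform A).
Proof. by move=> a u v; rewrite /rowform mulmxDl -scalemxAl !mxE. Qed.
HB.instance Definition _ r (A : 'cV[S]_r) :=
  GRing.isLinear.Build S _ S^o _ (rowform A) (rowform_is_linear A).

Lemma rowform_homog r (A : 'cV[S]_r) (sh : 'I_r -> nat) t v :
  (forall k m, m \in msupp (A k 0) -> mdeg m = sh k) ->
  row_homog sh t v -> msupp_in (fun m => mdeg m == t) (rowform A v).
Proof.
move=> hA hv; rewrite /rowform mxE; apply: msupp_in_sum => k.
move=> m; rewrite -mcoeff_msupp => /msuppM_le/allpairsP[[m1 m2] /=[]].
by rewrite mcoeff_msupp => /hv m1k /hA E ->; rewrite mdegD E.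
Qed.

Lemma mulmx_homog r r' (A : 'M[S]_(r, r')) sh sh' t v :
  (forall k l m, m \in msupp (A k l) -> (mdeg m + sh' l)%N = sh k) ->
  row_homog sh t v -> row_homog sh' t (v *m A).
Proof.
move=> hA hv l; rewrite mxE; apply: msupp_in_sum => k.
move=> m; rewrite -mcoeff_msupp => /msuppM_le/allpairsP[[m1 m2] /=[]].
by rewrite mcoeff_msupp => /hv m1k /hA E ->; rewrite mdegD -addnA E.
Qed.

Definition torow (f : S^o) : 'rV[S]_1 := const_mx f.

Lemma torow_is_linear : linear torow.
Proof. by move=> a u v; apply/rowP => k; rewrite !mxE. Qed.
HB.instance Definition _ := GRing.isLinear.Build S S^o _ _ torow torow_is_linear.

(** This is the ideal S, seen as a free module of rank one: coefficients of positive degree have no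
    constant term, so exactness applies. *)
Lemma reg_le_true : @reg_le K n xpredT 0.
Proof.
move=> w z _ Jz Dz.
have [|||y hy Ey] := @kd_exact_homog 1 (fun=> 0%N) w (kmap torow z).
- apply/kall_kmap; apply: kallW Jz => f Jf k.
  by rewrite mxE; apply: msupp_inW Jf => m; rewrite addn0.
- by rewrite kd_kmap_linear Dz; apply/kmap_eq0; apply: kall0; rewrite raddf0.
- move=> k; rewrite ktop_kmap mxE; apply/eqP/negP => /negP z0.
  by have /= := kall_ktop Jz 0%MM z0; rewrite mdeg0.
exists (kmap (rowform (const_mx 1)) y).
  apply/kall_kmap; apply: kallW hy => v hv.
  apply: msupp_inW (rowform_homog _ hv) => // k m; rewrite mxE.
  rewrite mcoeff_msupp mcoeff1.
  by have [->|_] := eqVneq m 0%MM; rewrite ?mdeg0 ?eqxx.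
rewrite kd_kmap_linear -Ey kmap_comp kmap_id //; apply: kall_all => v /=.
by rewrite /rowform mxE big_ord1 !mxE mulr1.
Qed.

End GradedProjection.

(** * Comparison with a minimal resolution *)

Section Betti.
Variables (K : fieldType) (n : nat) (I : {mpoly K[n]} -> Prop).
Local Notation S := {mpoly K[n]}.
Variables (F : min_graded_free_resolution I).
Variables (N : {set 'I_n} -> bool) (d : nat).
Hypothesis IE : forall f, I f <-> msupp_in (fun m => N (mset m)) f.
Hypothesis regN : @reg_le K n N d.
Local Notation l := (enum 'I_n).

Lemma res_kmap_exact0 (c : kos 'rV[S]_(res_rank F 0) l) :
  kmap (rowform (res_aug F)) c = 0 ->
  exists b, c = kmap (mulmxr (res_diff F 0)) b.
Proof.
move/kmap_eq0 => H.
case: (@kmap_lift _ _ _ _ (mulmxr (res_diff F 0)) (fun=> True) l c).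
  apply: kallW H => v v0; have /res_exact0[w Ew] : v *m res_aug F = 0.
    by apply/matrixP => i j; rewrite !ord1 [RHS]mxE.
  by exists w.
by move=> b; exists b.
Qed.

Lemma res_kmap_exactS i (c : kos 'rV[S]_(res_rank F i.+1) l) :
  kmap (mulmxr (res_diff F i)) c = 0 ->
  exists b, c = kmap (mulmxr (res_diff F i.+1)) b.
Proof.
move/kmap_eq0 => H.
case: (@kmap_lift _ _ _ _ (mulmxr (res_diff F i.+1)) (fun=> True) l c).
  by apply: kallW H => v /res_exactS[w Ew]; exists w.
by move=> b; exists b.
Qed.

Lemma res_diff_const0 i (v : 'rV[S]_(res_rank F i.+1)) k :
  ((v *m res_diff F i) 0 k)@_0 = 0.
Proof.
rewrite mxE raddf_sum big1 // => j _ /=.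
by rewrite rmorphM /= res_minimal mulr0.
Qed.

Lemma res_diff0_aug (v : 'rV[S]_(res_rank F 1)) :
  rowform (res_aug F) (v *m res_diff F 0) = 0.
Proof. by rewrite /rowform ((@res_exact0 _ _ _ F _).2 _) ?mxE //; exists v. Qed.

Lemma res_diff_diff i (v : 'rV[S]_(res_rank F i.+2)) :
  v *m res_diff F i.+1 *m res_diff F i = 0.
Proof. by apply/res_exactS; exists v. Qed.

(* The double complex of F and the Koszul complex: modulo the image of F, a   *)
(* Koszul cycle of large degree is a Koszul boundary. The induction goes down *)
(* the resolution, where exactness of the Koszul complex moves the class to   *)
(* the ideal itself.                                                          *)
Lemma res_koszul_boundary i w (c : kos 'rV[S]_(res_rank F i) l) e :
  (d <= w)%N -> kall (row_homog (@res_shift _ _ _ F i) (w.+1 + i)%N) c ->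
  kd c = kmap (mulmxr (res_diff F i)) e ->
  exists b b', c = kd b + kmap (mulmxr (res_diff F i)) b'.
Proof.
move=> dw; elim: i c e => [|i IH] c e hc Dc.
  have [||y Jy Ey] := regN dw (z := kmap (rowform (res_aug F)) c).
  - apply/kall_kmap; apply: kallW hc => v hv m fm; apply/andP; split.
      suff /IE : I (rowform (res_aug F) v) by apply.
      by apply/res_aug_image; exists v.
    by have := rowform_homog (@res_aug_homog _ _ _ F) hv fm; rewrite addn0.
  - rewrite kd_kmap_linear Dc kmap_comp; apply/kmap_eq0; apply: kall_all => v /=.
    exact: res_diff0_aug.
  have [b _ Eb] :
      exists2 b, kall (fun=> True) b & y = kmap (rowform (res_aug F)) b.
    apply: kmap_lift; apply: kallW Jy => f Jf.
    have /IE/(@res_aug_image _ _ _ F)[v Ev] : msupp_in (fun m => N (mset m)) f.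
      by apply: msupp_inW Jf => m /andP[].
    by exists v.
  have [|b' Eb'] := @res_kmap_exact0 (c - kd b).
    by rewrite kmapD kmapN -kd_kmap_linear -Eb -Ey subrr.
  by exists b, b'; rewrite -Eb' addrC subrK.
have [|||c' hc' Ec'] := @kd_exact_homog _ _ _ (@res_shift _ _ _ F i) (w.+1 + i)%N
  (kmap (mulmxr (res_diff F i)) c).
- apply/kall_kmap; apply: kallW hc => v hv; rewrite -addnS.
  by apply: mulmx_homog hv; apply: res_diff_homog.
- rewrite kd_kmap_linear Dc kmap_comp; apply/kmap_eq0; apply: kall_all => v.
  exact: res_diff_diff.
- by move=> k; rewrite ktop_kmap; apply: res_diff_const0.
have [b [b' Eb]] := IH _ _ hc' (esym Ec').
have [|b2 Eb2] := @res_kmap_exactS i (c - kd b').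
  have E : kmap (mulmxr (res_diff F i)) (kd b') =
           kd (kmap (mulmxr (res_diff F i)) b') by rewrite kd_kmap_linear.
  by rewrite kmapD kmapN E Ec' Eb kdD kdd add0r subrr.
by exists b', b2; rewrite -Eb2 addrC subrK.
Qed.

(** A basis vector of F_i has an entry 1, whereas Koszul boundaries in exterior degree 0 and, by
    minimality, images of the differential have entries without constant term. *)
Lemma betti_reg_le i j : betti F i j <> 0%N -> (j <= i + d)%N.
Proof.
rewrite /betti => /eqP; rewrite -lt0n => /card_gt0P[k]; rewrite inE => /eqP Ek.
rewrite leqNgt; apply/negP => ltj.
(* With w = j - i - 1 the total degree w + 1 + i is j, and j > i + d gives d <= w. *)
have [|||b [b' E]] := @res_koszul_boundary i (j - i).-1 (kinj l (delta_mx 0 k)) 0.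
- lia.
- have -> : ((j - i).-1.+1 + i)%N = j by lia.
  have H : row_homog (@res_shift _ _ _ F i) j
                     (delta_mx 0 k : 'rV[S]_(res_rank F i)).
    move=> k' m; rewrite mxE eqxx /=; have [->|_] := eqVneq k' k.
      by rewrite mcoeff1 Ek; have [->|_] := eqVneq m 0%MM; rewrite ?mdeg0 ?eqxx.
    by rewrite mcoeff0 eqxx.
  have H0 : row_homog (@res_shift _ _ _ F i) j (0 : 'rV[S]_(res_rank F i)).
    by move=> k' m; rewrite mxE mcoeff0 eqxx.
  by elim: l => //= a l' IH; split => //; apply: kall0 H0.
- by rewrite kd_kinj; apply/esym/kmap_eq0; apply: kall0; rewrite raddf0.
have := congr1 (fun c : kos 'rV[S]_(res_rank F i) l => (ktop c 0 k)@_0) E.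
rewrite ktop_kinj ktopD ktop_kmap.
rewrite [in RHS]mxE mcoeffD /= res_diff_const0 addr0 mxE !eqxx mcoeff1 eqxx.
have /in_varsmul_row /(_ k 0%MM) := ktop_kd b.
by rewrite mem_vars_enum eqxx => /contraNeq -> // /eqP; rewrite oner_eq0.
Qed.

End Betti.

(** * Simplicial vertices of chordal graphs *)

Lemma ex_least (P : nat -> Prop) :
  (exists k, P k) -> exists2 k, P k & forall j, P j -> (k <= j)%N.
Proof.
case=> k; elim/ltn_ind: k => k IH Pk.
have [[j [jk Pj]]|H] := classic (exists j, (j < k)%N /\ P j); first exact: IH Pj.
exists k => // j Pj; rewrite leqNgt; apply/negP => jk; apply: H; by exists j.
Qed.

Section SimplicialVertex.
Variables (n : nat) (e : rel 'I_n).
Hypotheses (e_sym : ssrbool.symmetric e) (e_irr : irreflexive e).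
Hypothesis e_chordal : chordal e.
Implicit Types (U X : {set 'I_n}) (x y z : 'I_n).

Definition simplicial U x : Prop :=
  forall y z, y \in U -> z \in U -> e x y -> e x z -> y != z -> e y z.

Definition walk X x y L (w : nat -> 'I_n) : Prop :=
  [/\ w 0 = x, w L = y, (forall i, (i < L)%N -> e (w i) (w i.+1))
    & (forall i, (0 < i < L)%N -> w i \in X)].

(** In a walk of least length, a repeated vertex or a chord would allow a shortcut; the new walk
    reindexes the part after the cut. *)
Lemma shortest_walk X x y :
  y \notin X -> (exists L w, walk X x y L w) ->
  exists L w, [/\ walk X x y L w,
    (forall i j, (i < j <= L)%N -> w i != w j) &
    (forall i j, (i.+1 < j <= L)%N -> ~~ e (w i) (w j))].
Proof.
move=> yX /ex_least[L [w Ww] Lmin]; exists L, w; split=> // i j ij.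
- case: Ww => w0 wL we wX; apply/eqP => Eij.
  have : (L <= L - (j - i))%N; last by lia.
  apply: Lmin; exists (fun t => if (t <= i)%N then w t else w (t + (j - i))%N).
  split=> [||t tL|t tL].
  + by [].
  + case: ifP => h; last by rewrite -wL; congr w; lia.
    have -> : (L - (j - i) = i)%N by lia.
    by rewrite Eij -wL; congr w; lia.
  + case: (ltngtP t i) => ti.
    * by apply: we; lia.
    * by rewrite addSn; apply: we; lia.
    * rewrite ti Eij.
      have -> : (i.+1 + (j - i))%N = j.+1 by lia.
      by apply: we; lia.
  + by case: ifP => h; apply: wX; lia.
- case: Ww => w0 wL we wX; apply/negP => Eij.
  have : (L <= L - (j - i.+1))%N; last by lia.
  apply: Lmin; exists (fun t => if (t <= i)%N then w t else w (t + (j - i.+1))%N).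
  split=> [||t tL|t tL].
  + by [].
  + case: ifP => h; last by rewrite -wL; congr w; lia.
    by lia.
  + case: (ltngtP t i) => ti.
    * by apply: we; lia.
    * by rewrite addSn; apply: we; lia.
    * rewrite ti.
      by have -> : (i.+1 + (j - i.+1))%N = j by lia.
  + by case: ifP => h; apply: wX; lia.
Qed.

Lemma ordS_eq k (i j : 'I_k) :
  (j == ordS i) = if i.+1 == k then (j == 0 :> nat)%N else (j == i.+1 :> nat)%N.
Proof.
rewrite -val_eqE /=; case: (i.+1 =P k) => [->|ik]; first by rewrite modnn.
by rewrite modn_small //; have := ltn_ord i; lia.
Qed.

(* A shortest path through X and a vertex r off X adjacent to both of its     *)
(* ends close up to an induced cycle.                                         *)
Lemma chordal_separator X x y r :
  x \notin X -> y \notin X -> x != y -> (exists L w, walk X x y L w) ->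
  (forall z, z \in X -> ~~ e r z) -> r \notin X -> e r x -> e r y -> e x y.
Proof.
move=> xX yX xy /(shortest_walk yX)[L [w [[w0 wL we wX] winj wshort]]].
move=> rX rnX rx ry.
apply/negPn/negP => exy.
have L2 : (1 < L)%N.
  case: L wL we {wX winj wshort} => [|[|L]] // wL we.
    by rewrite -w0 -wL eqxx in xy.
  by move: (we 0 isT); rewrite w0 wL (negbTE exy).
have wr i : (i <= L)%N -> w i != r /\ e r (w i) = ((i == 0) || (i == L))%N.
  move=> iL; have [->|i0] := posnP i.
    by rewrite w0 rx; split=> //; apply: contraTneq rx => ->; rewrite e_irr.
  have [->|iL'] := eqVneq i L.
    by rewrite wL ry orbT; split=> //; apply: contraTneq ry => ->; rewrite e_irr.
  have wiX : w i \in X by apply: wX; lia.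
  rewrite (negbTE (rX _ wiX)); split; last by lia.
  by apply: contraNneq rnX => <-.
have ewE i j : (i < j <= L)%N -> e (w i) (w j) = (j == i.+1).
  move=> ij; have [->|ne] := eqVneq j i.+1; first by apply: we; lia.
  by apply/negbTE/wshort; lia.
(* The cycle consists of the L + 1 vertices of the path and of r, so L > 1 makes its length at least
   4. *)
pose c (i : 'I_L.+2) := if (i <= L)%N then w i else r.
apply: (e_chordal (c := c)); first by rewrite !ltnS.
split=> [i j|i j]; rewrite /c.
  have := ltn_ord i; have := ltn_ord j.
  case: ifP => iL; case: ifP => jL jL2 iL2 E.
  - apply/val_inj => /=; apply/eqP/negPn/negP; rewrite neq_ltn => /orP[] ij.
      by have /negP[] := winj i j ltac:(lia); rewrite E.
    by have /negP[] := winj j i ltac:(lia); rewrite E.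
  - by have [/negP[]] := wr i iL; rewrite E.
  - by have [/negP[]] := wr j jL; rewrite -E.
  - by apply/val_inj => /=; lia.
rewrite !ordS_eq; have := ltn_ord i; have := ltn_ord j.
case: ifP => iL; case: ifP => jL jL2 iL2.
- have [ij|ij|ij] := ltngtP i j.
  + by rewrite ewE; do ?case: ifP; lia.
  + by rewrite e_sym ewE; do ?case: ifP; lia.
  + by rewrite ij e_irr; do ?case: ifP; lia.
- by rewrite e_sym (wr i iL).2; do ?case: ifP; lia.
- by rewrite (wr j jL).2; do ?case: ifP; lia.
- by rewrite e_irr; do ?case: ifP; lia.
Qed.

Definition connected_in X : bool :=
  [forall x in X, forall y in X,
     connect [rel u v | [&& e u v, u \in X & v \in X]] x y].

Lemma connected_walk X x y u v :
  connected_in X -> u \in X -> e x u -> v \in X -> e v y ->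
  exists L w, walk X x y L w.
Proof.
move=> /forall_inP/(_ u) conX uX xu vX vy.
have /connectP[p pp Ev] := forall_inP (conX uX) v vX.
have pX : all (mem X) (u :: p).
  rewrite /= uX /=; elim: p u pp {Ev conX xu uX} => //= z p IH u.
  by by case/andP => /and3P[_ _ zX] /IH pX; apply/andP.
pose s := rcons (u :: p) y.
have ps : path e x s.
  rewrite rcons_path /= xu -Ev vy !andbT.
  by apply: sub_path pp => a b /= /and3P[].
exists (size s), (nth x (x :: s)); split=> //.
- by rewrite -last_nth last_rcons.
- by move=> i iL; apply: (pathP x ps).
- move=> [//|i]; rewrite /= size_rcons => iL.
  have {}iL : (i < size (u :: p))%N by [].
  rewrite -[nth _ _ _]/(nth x s i) nth_rcons iL.
  by apply: (allP pX); apply: mem_nth.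
Qed.

Lemma connected1 x : connected_in [set x].
Proof.
apply/forall_inP => a /set1P ->; apply/forall_inP => b /set1P ->; exact: connect0.
Qed.

Lemma connectedU1 X x y :
  connected_in X -> x \in X -> e x y -> connected_in (y |: X).
Proof.
move=> conX xX xy; set R := [rel u v | [&& e u v, u \in y |: X & v \in y |: X]].
have sR : connect_sym R.
  by apply: sym_connect_sym => a b; rewrite /= e_sym; congr andb; apply: andbC.
have cx a : a \in y |: X -> connect R x a.
  case/setU1P => [->|aX].
    by apply: connect1; rewrite /= xy !inE xX eqxx orbT.
  have := forall_inP (forall_inP conX x xX) a aX; apply: connect_sub => b c.
  by case/and3P => bc bX cX; apply: connect1; rewrite /= bc !inE bX cX !orbT.
apply/forall_inP => a aX; apply/forall_inP => b bX.
by apply: connect_trans (cx b bX); rewrite sR; apply: cx.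
Qed.

(* Dirac: among the connected X that do not dominate U, a largest one has a   *)
(* boundary B which is a clique and completely joined to the set R of the     *)
(* vertices of U away from X; a simplicial vertex of R is simplicial in U.    *)
Lemma exists_simplicial U : U != set0 -> exists2 x, x \in U & simplicial U x.
Proof.
have [k] := ubnP #|U|; elim: k U => // k IH U Uk /set0Pn[a aU].
have [sa|] := classic (simplicial U a); first by exists a.
case/not_all_ex_not => b /not_all_ex_not[c nsa].
have [bU {}nsa] := imply_to_and _ _ nsa; have [cU {}nsa] := imply_to_and _ _ nsa.
have [ab {}nsa] := imply_to_and _ _ nsa; have [ac {}nsa] := imply_to_and _ _ nsa.
have [bc /negP nbc] := imply_to_and _ _ nsa.
pose fam X := [&& X \subset U, X != set0, connected_in X &
  [exists r in U :\: X, [forall x in X, ~~ e r x]]].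
have fam_b : fam [set b].
  rewrite /fam sub1set bU connected1 -card_gt0 cards1 /=.
  apply/exists_inP; exists c; first by rewrite !inE eq_sym bc.
  by apply/forall_inP => x /set1P ->; rewrite e_sym.
case: (arg_maxnP (fun X : {set 'I_n} => #|X|) fam_b) => X /and4P[XU X0 conX].
case/exists_inP => r0 r0UX /forall_inP r0X Xmax.
pose R := [set r in U :\: X | [forall x in X, ~~ e r x]].
have [r rR sr] : exists2 r, r \in R & simplicial R r.
  apply: IH; last first.
    apply/set0Pn; exists r0; rewrite !inE in r0UX *.
    by rewrite r0UX; apply/forall_inP.
  rewrite -ltnS; apply: leq_trans Uk; rewrite ltnS.
  apply: proper_card; apply/properP; split.
    by apply/subsetP => r; rewrite !inE => /andP[/andP[]].
  have [x xX] := set0Pn _ X0; exists x; first exact: (subsetP XU).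
  by rewrite !inE xX.
have RP z : z \in R -> [/\ z \in U, z \notin X & forall x, x \in X -> ~~ e z x].
  by rewrite !inE => /andP[/andP[-> ->] /forall_inP].
have [rU rX rnX] := RP r rR.
exists r => // y z yU zU ry rz yz.
have notX v : e r v -> v \notin X by apply: contraTN => /rnX.
have outR v : v \in U -> e r v -> v \notin R -> exists2 x, x \in X & e v x.
  move=> vU rv; rewrite !inE vU notX //= negb_forall => /existsP[x].
  by rewrite negb_imply negbK => /andP[xX vx]; exists x.
have join v q : v \in U -> e r v -> v \notin R -> q \in R -> e v q.
  move=> vU rv vR qR; have [x xX vx] := outR v vU rv vR.
  have [qU qX qnX] := RP q qR; apply: contraNT (vR) => nvq.
  (* If v and q were not adjacent, X + v would still be connected and leave q undominated, against
     the maximality of X. *)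
  have /Xmax : fam (v |: X).
    apply/and4P; split.
    - by rewrite subUset sub1set vU.
    - by apply/set0Pn; exists v; rewrite setU11.
    - by apply: (connectedU1 conX xX); rewrite e_sym.
    apply/exists_inP; exists q.
      by rewrite !inE qU (negbTE qX) orbF andbT; apply: contraNneq vR => <-.
    by apply/forall_inP => w /setU1P[->|/qnX //]; rewrite e_sym.
  by rewrite cardsU1 notX //= add1n ltnn.
have [yR|yR] := boolP (y \in R); have [zR|zR] := boolP (z \in R).
- exact: sr.
- by rewrite e_sym join.
- by rewrite join.
(* Both y and z have neighbours in the connected set X, and r has none there: the separator argument
   makes them adjacent. *)
have [u uX yu] := outR y yU ry yR; have [v vX zv] := outR z zU rz zR.
apply: (@chordal_separator X y z r) => //; try exact: notX.
by apply: (connected_walk conX uX yu vX); rewrite e_sym.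
Qed.
End SimplicialVertex.

(** * Vertex covers and ordered matchings *)

Section CoverNumber.
Variables (n : nat) (e : rel 'I_n).
Hypotheses (e_sym : ssrbool.symmetric e) (e_irr : irreflexive e).
Implicit Types (A B C U : {set 'I_n}) (x y z : 'I_n).

Definition covers A C : bool :=
  [forall x in A, forall y in A, e x y ==> (x \in C) || (y \in C)].

Lemma coversP A C :
  reflect {in A &, forall x y, e x y -> (x \in C) || (y \in C)} (covers A C).
Proof.
apply: (iffP forall_inP) => H x.
  by move=> y xA yA; apply/implyP; apply: (forall_inP (H x xA)).
by move=> xA; apply/forall_inP => y yA; apply/implyP; apply: H.
Qed.

Definition cover_ge s A : bool := [forall C, covers A C ==> (s <= #|C|)%N].

Lemma cover_geP s A :
  reflect (forall C, covers A C -> (s <= #|C|)%N) (cover_ge s A).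
Proof. by apply: (iffP forallP) => H C; apply/implyP; apply: H. Qed.

Lemma cover_ge_mono s : {homo cover_ge s : A B / A \subset B >-> A ==> B}.
Proof.
move=> A B /subsetP AB; apply/implyP => /cover_geP H; apply/cover_geP => C.
by move=> /coversP CB; apply: H; apply/coversP => x y /AB xB /AB; apply: CB.
Qed.

Lemma cover_ge0 A : cover_ge 0 A. Proof. exact/cover_geP. Qed.

Lemma cover_ge_set0 s : cover_ge s set0 = (s == 0%N).
Proof.
apply/cover_geP/eqP => [/(_ set0)|-> //].
by rewrite cards0 leqn0 => H; apply/eqP/H/coversP => x y; rewrite inE.
Qed.

Lemma cover_ge_isolated s A x :
  {in A, forall y, ~~ e x y} -> cover_ge s (x |: A) = cover_ge s A.
Proof.
move=> nx; apply/idP/idP; last exact/implyP/cover_ge_mono/subsetUr.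
move=> /cover_geP H; apply/cover_geP => C /coversP CA; apply: H; apply/coversP.
move=> y z /setU1P[->|yA] /setU1P[->|zA]; rewrite ?e_irr //.
- by rewrite (negbTE (nx _ zA)).
- by rewrite e_sym (negbTE (nx _ yA)).
- exact: CA.
Qed.

(* Some minimum cover of B + y contains y.                                    *)
Lemma cover_ge_simplicial s B x y :
  x \in B -> y \notin B -> e x y -> {in B, forall z, e x z -> e y z} ->
  cover_ge s.+1 (y |: B) = cover_ge s B.
Proof.
move=> xB yB xy nbr; have D1 A z : (#|A| <= #|A :\ z|.+1)%N.
  by rewrite (cardsD1 z A) -add1n leq_add2r; case: (z \in A).
apply/cover_geP/cover_geP => H C.
  move=> /coversP CB; rewrite -ltnS; apply: leq_trans (H (y |: C) _) _.
    apply/coversP => u v; rewrite !inE.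
    by case: eqP => //= _ uB; case: eqP; rewrite ?orbT //= => _ vB; apply: CB.
  by rewrite cardsU1; case: (y \in C).
move=> /coversP CB.
have subB u : u \in B -> u \in y |: B by rewrite inE orbC => ->.
have [yC|yC] := boolP (y \in C).
  rewrite (cardsD1 y) yC add1n ltnS; apply: H; apply/coversP => u v uB vB uv.
  rewrite !inE; have -> : u != y by apply: contraNneq yB => <-.
  have -> : v != y by apply: contraNneq yB => <-.
  by apply: CB; rewrite ?subB.
have nbrC z : z \in y |: B -> e y z -> z \in C.
  by move=> zB yz; have := CB y z (setU11 _ _) zB yz; rewrite (negbTE yC).
have xC : x \in C by apply: nbrC; rewrite ?subB // e_sym.
rewrite (cardsD1 x) xC add1n ltnS; apply: H; apply/coversP => u v uB vB uv.
rewrite !inE.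
have [ux|ux] := eqVneq u x.
  have xv : e x v by rewrite -ux.
  rewrite (nbrC v) ?subB ?nbr //= andbT.
  by apply: contraTneq xv => ->; rewrite e_irr.
have [vx|vx] := eqVneq v x.
  have xu : e x u by rewrite -vx e_sym.
  by rewrite (nbrC u) ?subB ?nbr.
by apply: CB; rewrite ?subB.
Qed.

(** Covers of G restrict to covers of G[A], and a cover C of G[A] extends to G by adding all
    vertices outside A. *)
Lemma cover_ge_vertex_cover s A :
  cover_ge s A = [forall C, vertex_cover e C ==> (s <= #|A :&: C|)%N].
Proof.
apply/cover_geP/forall_inP => H C.
  move=> /forallP HC; apply: H; apply/coversP => x y xA yA xy.
  by rewrite !inE xA yA; have /forallP/(_ y)/implyP/(_ xy) := HC x.
move=> /coversP CA; apply: leq_trans (H (C :|: ~: A) _) _.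
  apply/forallP => x; apply/forallP => y; apply/implyP => xy; rewrite !inE.
  have [xA|xA] := boolP (x \in A); last by rewrite orbT.
  have [yA|yA] := boolP (y \in A); last by rewrite !orbT.
  by rewrite !orbF; apply: CA.
by rewrite setIUr setICr setU0 subset_leq_card // subsetIr.
Qed.

End CoverNumber.

(** * Ordered matchings of induced subgraphs *)

Section OrderedMatchings.
Variables (n : nat).
Implicit Types (e : rel 'I_n) (U V : {set 'I_n}) (x y z : 'I_n).

Lemma ordered_matching_le e r (a b : {ffun 'I_r -> 'I_n}) :
  ordered_matching e a b -> (r <= ord_match e)%N.
Proof.
move=> oab; have rn : (r < n.+1)%N.
  rewrite ltnS; have /and5P[_ _ /forallP dis _ _] := oab.
  suff /leq_card : injective a by rewrite !card_ord.
  move=> i j Eij; apply/eqP/negPn/negP => ij.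
  have /forallP/(_ j)/implyP/(_ ij) := dis i; rewrite Eij => /pred0P/(_ (a j)).
  by rewrite /= !inE eqxx.
rewrite /ord_match (bigD1 (Ordinal rn)) /=; first exact: leq_maxl.
by apply/existsP; exists a; apply/existsP; exists b.
Qed.

(** The vertex type stays ['I_n]; vertices outside [U] become isolated. *)
Definition induced e U : rel 'I_n :=
  fun x y => [&& e x y, x \in U & y \in U].
Arguments induced e U x y /.

Lemma ord_match_sup e :
  ord_match e = 0%N \/
  exists (a b : {ffun 'I_(ord_match e) -> 'I_n}), ordered_matching e a b.
Proof.
rewrite /ord_match; elim/big_ind: _ => [|p q Hp Hq|r]; first by left.
  by rewrite /maxn; case: ifP.
by case/existsP => a /existsP[b oab]; right; exists a, b.
Qed.

Lemma ord_match_induced_sub e U V :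
  U \subset V -> (ord_match (induced e U) <= ord_match (induced e V))%N.
Proof.
move=> /subsetP UV; case: (ord_match_sup (induced e U)) => [-> //|[a [b]]].
case/and5P => r0 /forallP ab dis /forallP ind /forallP ord.
have aU i : a i \in U by have /and3P[] := ab i.
have bU i : b i \in U by have /and3P[] := ab i.
apply: (@ordered_matching_le _ _ a b); apply/and5P; split => //.
- by apply/forallP => i; have /and3P[abi _ _] := ab i; rewrite /= abi !UV.
- apply/forallP => i; apply/forallP => j; have /forallP/(_ j) := ind i.
  by rewrite /= !aU !UV.
- apply/forallP => i; apply/forallP => j; have /forallP/(_ j) := ord i.
  by rewrite /= aU bU !UV.
Qed.

(* x has no neighbour among the other matched vertices, so the edge xy can be *)
(* put at the end of an ordered matching of the rest.                         *)
Lemma ord_match_induced_step e U x y :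
  ssrbool.symmetric e -> irreflexive e -> x \in U -> y \in U -> e x y ->
  (ord_match (induced e (U :\: [set z | (z == x) || e x z])) <
   ord_match (induced e U))%N.
Proof.
move=> e_sym e_irr xU yU xy; set W := U :\: _; set m := ord_match _.
have [a [b [ab dis ind ord]]] : exists (a b : {ffun 'I_m -> 'I_n}),
    [/\ forall i, induced e W (a i) (b i),
        forall i j, i != j -> [disjoint [set a i; b i] & [set a j; b j]],
        forall i j, ~~ induced e W (a i) (a j)
      & forall i j, induced e W (a i) (b j) -> (i <= j)%N].
  (* An ordered matching is nonempty by definition, so m = 0 is served by functions on the empty
     type. *)
  case: (ord_match_sup (induced e W)) => [m0|[a [b]]].
    have no (i : 'I_m) : False by case: i => i; rewrite /m m0.
    by exists [ffun=> x], [ffun=> x]; split=> i; case: (no i).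
  case/and5P => _ /forallP ab /forallP dis /forallP ind /forallP ord.
  exists a, b; split=> // i j.
  - by apply/implyP; apply: (forallP (dis i)).
  - exact: (forallP (ind i)).
  - by apply/implyP; apply: (forallP (ord i)).
have WP z : z \in W -> [/\ z \in U, z != x & ~~ e x z].
  by rewrite !inE negb_or => /andP[/andP[-> ->] ->].
have aW i : a i \in W by have /and3P[] := ab i.
have bW i : b i \in W by have /and3P[] := ab i.
pose ext (c : {ffun 'I_m -> 'I_n}) z : {ffun 'I_m.+1 -> 'I_n} :=
  [ffun i => if unlift ord_max i is Some j then c j else z].
apply: (@ordered_matching_le _ _ (ext a x) (ext b y)).
have nW z i : (z == x) || e x z -> (a i != z) && (b i != z).
  move=> zW; have zNW : z \notin W by rewrite !inE zW.
  by apply/andP; split; apply: contraNneq zNW => <-.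
have xW i := nW x i ltac:(by rewrite eqxx).
have yW i := nW y i ltac:(by rewrite xy orbT).
apply/and5P; split => //.
- apply/forallP => i; rewrite !ffunE; case: unliftP => [j _|_] /=.
    have /and3P[-> aj bj] := ab j.
    by have [-> _ _] := WP _ aj; have [-> _ _] := WP _ bj.
  by rewrite xy xU.
- apply/forallP => i; apply/forallP => j; apply/implyP => ij; rewrite !ffunE.
  have newdis k : [disjoint [set a k; b k] & [set x; y]].
    rewrite disjoints_subset; apply/subsetP => z; rewrite !inE negb_or.
    have /andP[ax bx] := xW k; have /andP[ay b_y] := yW k.
    by case/orP => /eqP ->; apply/andP.
  move: ij; case: unliftP => [i' ->|->]; case: unliftP => [j' ->|->] ij.
  + by apply: dis; apply: contraNneq ij => ->.
  + exact: newdis.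
  + by rewrite disjoint_sym; apply: newdis.
  + by rewrite eqxx in ij.
- apply/forallP => i; apply/forallP => j; rewrite !ffunE.
  case: unliftP => [i' _|_]; case: unliftP => [j' _|_].
  + have := ind i' j'; rewrite /= !aW !andbT.
    have [-> _ _] := WP _ (aW i'); have [-> _ _] := WP _ (aW j').
    by rewrite !andbT.
  + by have [_ _ /negbTE xa] := WP _ (aW i'); rewrite /= e_sym xa.
  + by have [_ _ /negbTE xa] := WP _ (aW j'); rewrite /= xa.
  + by rewrite /= e_irr.
- apply/forallP => i; apply/forallP => j; rewrite !ffunE; apply/implyP.
  case: unliftP => [i' ->|->]; case: unliftP => [j' ->|->].
  + by rewrite !lift_max => /and3P[eab _ _]; apply: ord; rewrite /= eab aW bW.
  + by move=> _; rewrite lift_max; apply/ltnW/ltn_ord.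
  + by have [_ _ /negbTE xb] := WP _ (bW j'); rewrite /= xb.
  + by [].
Qed.

End OrderedMatchings.

(** * Induction along simplicial vertices *)

Section ChordalRegularity.
Variables (K : fieldType) (n : nat) (e : rel 'I_n).
Hypotheses (e_sym : ssrbool.symmetric e) (e_irr : irreflexive e).
Hypothesis e_chordal : chordal e.
Implicit Types (A U : {set 'I_n}) (x y : 'I_n).
Local Notation om U := (ord_match (induced e U)).
Local Notation reg_le := (@reg_le K n).
Local Notation closed_nbh x := [set z | (z == x) || e x z].

Let reg_le_all (N : {set 'I_n} -> bool) d : (forall A, N A) -> reg_le N d.
Proof.
move=> NT; apply: (@reg_leW _ _ _ 0) => //.
by apply: eq_reg_le (@reg_le_true K n) => A; rewrite NT.
Qed.

(** The ideal is the colon by x of the ideal of (G[U], s). Splitting along a neighbour y of x leads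
    to U - y with s, and to U - y with s - 1 for the colon; W is unchanged because y lies in
    N[x]. *)
Lemma reg_le_simplicial U x s W :
  x \in U -> simplicial e U x -> W = U :\: closed_nbh x ->
  (forall s', reg_le (fun A => cover_ge e s' (A :&: W)) (s' + om W)%N) ->
  reg_le (fun A => cover_ge e s (x |: (A :&: U))) (s + om W)%N.
Proof.
move=> xU sx EW regW; have [k] := ubnP #|U|.
elim: k => // k IH in U s xU sx EW *; rewrite ltnS => Uk.
have [/existsP[y /andP[yU xy]]|/existsPn nbr0] :=
  boolP [exists y, (y \in U) && e x y]; last first.
  (* No neighbour of x is left, so U and W agree up to x, which is isolated. *)
  apply: eq_reg_le (regW s) => A.
  have -> : x |: (A :&: U) = x |: (A :&: W).
    apply/setP => z; rewrite EW !inE; case: (z =P x) => //= _.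
    by have := nbr0 z; case: (z \in U); rewrite ?andbF //= => ->.
  rewrite cover_ge_isolated // => y; rewrite EW !inE.
  by case/andP => _ /andP[/norP[]].
case: s => [|s]; first by apply: reg_le_all => A; apply: cover_ge0.
have yx : y != x by apply: contraTneq xy => ->; rewrite e_irr.
have xUy : x \in U :\ y by rewrite !inE eq_sym yx.
have sxy : simplicial e (U :\ y) x.
  by move=> u v /setD1P[_ uU] /setD1P[_ vU]; apply: sx.
have EWy : W = (U :\ y) :\: closed_nbh x.
  rewrite EW; apply/setP => z; rewrite !inE.
  by case: (z =P y) => [->|_] //=; rewrite xy orbT.
have cardU : (#|U :\ y| < k)%N.
  by apply: leq_trans Uk; rewrite [X in (_ <= X)%N](cardsD1 y) yU.
apply: (reg_le_split (x := y)).
- move=> A B AB; apply: cover_ge_mono; exact/setUS/setSI.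
- apply: eq_reg_le (IH _ s.+1 xUy sxy EWy cardU) => A.
  by congr cover_ge; congr setU; apply/setP => z; rewrite !inE andbCA andbA.
- apply: eq_reg_le (IH _ s xUy sxy EWy cardU) => A.
  have -> : x |: ((y |: A) :&: U) = y |: (x |: (A :&: (U :\ y))).
    apply/setP => z; rewrite !inE; case: (z =P y) => [->|_] /=.
      by rewrite yU orbT.
    by [].
  rewrite (@cover_ge_simplicial _ _ e_sym e_irr s _ x) //.
  + by rewrite setU11.
  + by rewrite !inE eqxx (negbTE yx) /= andbF.
  + move=> z; rewrite !inE => /orP[/eqP ->|/and3P[_ zy zU] xz].
      by rewrite e_irr.
    by apply: sx => //; rewrite eq_sym.
Qed.

(** An isolated simplicial vertex can be deleted. Otherwise the split along x uses U - x, and for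
    the colon [reg_le_simplicial], whose bound is smaller by at least one. *)
Lemma reg_le_chordal U s :
  reg_le (fun A => cover_ge e s (A :&: U)) (s + om U)%N.
Proof.
have [k] := ubnP #|U|; elim: k => // k IH in U s *; rewrite ltnS => Uk.
have [->|U0] := eqVneq U set0.
  (* Without vertices the ideal is S for s = 0 and zero for s > 0. *)
  case: s => [|s]; first by apply: reg_le_all => A; apply: cover_ge0.
  by apply: reg_le_false => A; rewrite setI0 cover_ge_set0.
have [x xU sx] := exists_simplicial e_sym e_irr e_chordal U0.
have ltU (V : {set 'I_n}) : V \subset U -> x \notin V -> (#|V| < k)%N.
  move=> VU xV; apply: leq_trans Uk; apply: proper_card; apply/properP.
  by split=> //; exists x.
have delx A : (A :\ x) :&: U = A :&: (U :\ x).
  by apply/setP => z; rewrite !inE andbCA andbA.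
have Ux : (#|U :\ x| < k)%N by rewrite ltU ?subD1set // !inE eqxx.
have regUx : reg_le (fun A => cover_ge e s (A :&: (U :\ x))) (s + om U)%N.
  apply: reg_leW (IH _ s Ux); rewrite leq_add2l.
  by apply: ord_match_induced_sub; apply: subD1set.
have [/existsP[y /andP[yU xy]]|/existsPn nbr0] :=
  boolP [exists y, (y \in U) && e x y]; last first.
  apply: eq_reg_le regUx => A.
  have [xA|xA] := boolP (x \in A); last first.
    congr cover_ge; apply/setP => z; rewrite !inE.
    by case: eqP => // ->; rewrite (negbTE xA).
  rewrite -(@cover_ge_isolated _ _ e_sym e_irr _ _ x).
    congr cover_ge; apply/setP => z; rewrite !inE.
    by case: eqP => // ->; rewrite xA xU.
  move=> y; rewrite !inE => /and3P[_ _ yU].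
  by have := nbr0 y; rewrite yU.
set W := U :\: closed_nbh x.
have omW : (om W < om U)%N := ord_match_induced_step e_sym e_irr xU yU xy.
have regW s' : reg_le (fun A => cover_ge e s' (A :&: W)) (s' + om W)%N.
  by apply: IH; apply: ltU; rewrite ?subsetDl // !inE eqxx.
have regx := @reg_le_simplicial U x s W xU sx erefl regW.
case Em: (om U) omW regUx => [//|m] omW regUx; rewrite addnS in regUx *.
apply: (reg_le_split (x := x)).
- move=> A B AB; apply: cover_ge_mono; exact: setSI.
- by apply: eq_reg_le regUx => A; rewrite delx.
- apply: (@reg_leW _ _ _ (s + om W)%N); first by rewrite leq_add2l.
  apply: eq_reg_le regx => A; congr cover_ge.
  by apply/setP => z; rewrite !inE; case: eqP => // ->; rewrite xU.
Qed.

Lemma reg_le_cover s : reg_le (cover_ge e s) (s + ord_match e)%N.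
Proof.
have eT x y : induced e [set: 'I_n] x y = e x y.
  by rewrite /induced !in_setT !andbT.
have omT : (om [set: 'I_n] <= ord_match e)%N.
  case: (ord_match_sup (induced e setT)) => [-> //|[a [b oab]]].
  apply: (@ordered_matching_le _ e _ a b); move: oab.
  case/and5P => r0 /forallP ab dis /forallP ind /forallP ord.
  apply/and5P; split=> //.
  - by apply/forallP => i; rewrite -eT.
  - apply/forallP => i; apply/forallP => j; rewrite -eT.
    exact: (forallP (ind i)).
  - apply/forallP => i; apply/forallP => j; rewrite -eT.
    exact: (forallP (ord i)).
apply: (@reg_leW _ _ _ (s + om [set: 'I_n])%N); first by rewrite leq_add2l.
by apply: eq_reg_le (@reg_le_chordal [set: 'I_n] s) => A; rewrite setIT.
Qed.

End ChordalRegularity.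

(** * Squarefree parts of symbolic powers *)

Section SymbolicPower.
Variables (K : fieldType) (n : nat) (e : rel 'I_n).
Hypothesis e_irr : irreflexive e.
Local Notation S := {mpoly K[n]}.
Implicit Types (A B C : {set 'I_n}) (P : {set {set 'I_n}}) (f g h : S).
Implicit Types (m : 'X_{1..n}).

Lemma ideal_gen_msupp (X : S -> Prop) (Q : pred 'X_{1..n}) f :
  (forall m m', Q m -> Q (m' + m)%MM) -> (forall g, X g -> msupp_in Q g) ->
  ideal_gen X f -> msupp_in Q f.
Proof.
move=> Qup XQ [r [g [h [Xh ->]]]]; apply: msupp_in_sum => k.
by apply: msupp_inM (XQ _ (Xh k)); apply: Qup.
Qed.

Lemma ideal_genX (X : S -> Prop) g h : X h -> ideal_gen X (g * h).
Proof.
by move=> Xh; exists 1%N, (fun=> g), (fun=> h); split=> //; rewrite big_ord1.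
Qed.

Lemma ideal_gen_mem (X : S -> Prop) h : X h -> ideal_gen X h.
Proof. by move=> Xh; rewrite -[h]mul1r; apply: ideal_genX. Qed.

Lemma ideal_gen0 (X : S -> Prop) : ideal_gen X 0.
Proof.
by exists 0%N, (fun=> 0), (fun=> 0); split=> [[]|] //; rewrite big_ord0.
Qed.

Lemma ideal_genD (X : S -> Prop) f1 f2 :
  ideal_gen X f1 -> ideal_gen X f2 -> ideal_gen X (f1 + f2).
Proof.
move=> [r1 [g1 [h1 [X1 ->]]]] [r2 [g2 [h2 [X2 ->]]]].
exists (r1 + r2)%N,
  (fun k => match split k with inl i => g1 i | inr i => g2 i end),
  (fun k => match split k with inl i => h1 i | inr i => h2 i end); split.
  by move=> k; case: split.
rewrite big_split_ord /=; congr +%R; apply: eq_bigr => i _.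
  by rewrite (unsplitK (inl i)).
by rewrite (unsplitK (inr i)).
Qed.

Lemma mpolyX_sub m m' : (m <= m')%MM -> 'X_[m'] = 'X_[m' - m] * 'X_[m] :> S.
Proof. by move=> mm; rewrite -mpolyXD submK. Qed.

Lemma ideal_gen_monomials (X : S -> Prop) (Q : pred 'X_{1..n}) f :
  (forall m, Q m -> exists2 m', (m' <= m)%MM & X 'X_[m']) ->
  msupp_in Q f -> ideal_gen X f.
Proof.
move=> QX Qf; rewrite [f]mpolyE big_seq.
elim/big_ind: _ => [||m mf]; [exact: ideal_gen0|exact: ideal_genD|].
rewrite mcoeff_msupp in mf; have [m' mm' Xm'] := QX m (Qf m mf).
by rewrite (mpolyX_sub mm') scalerAl; apply: ideal_genX.
Qed.

Lemma var_idealP A f :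
  var_ideal A f <-> msupp_in (fun m => [exists i in A, m i != 0%N]) f.
Proof.
split.
  apply: ideal_gen_msupp => [m m' /exists_inP[i iA mi]|g [i iA ->] m].
    by apply/exists_inP; exists i; rewrite // mnmDE; lia.
  rewrite mcoeffX; have [<- _|_] := eqVneq U_(i)%MM m; last by rewrite eqxx.
  by apply/exists_inP; exists i; rewrite // mnm1E eqxx.
apply: ideal_gen_monomials => m /exists_inP[i iA mi]; exists U_(i)%MM.
  by apply/mnm_lepP => j; rewrite mnm1E; case: eqP => [<-|] //=; lia.
by exists i.
Qed.

(** The largest s such that the monomial lies in the s-th power of the prime generated by the
    variables of [A]. *)
Definition weight A (m : 'X_{1..n}) : nat := (\sum_(i in A) m i)%N.

Lemma weightD A m m' : weight A (m + m')%MM = (weight A m + weight A m')%N.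
Proof. by rewrite /weight -big_split; apply: eq_bigr => i _; rewrite mnmDE. Qed.

Lemma ideal_pow_var_weight A s f :
  ideal_pow (var_ideal A) s f -> msupp_in (fun m => (s <= weight A m)%N) f.
Proof.
apply: ideal_gen_msupp => [m m' h|g [h [hA ->]]]; first by rewrite weightD; lia.
elim: s h hA => [|s IH] h hA; first by move=> m.
rewrite big_ord_recl => m; rewrite -mcoeff_msupp.
move=> /msuppM_le/allpairsP[[m1 m2] /=[]].
rewrite !mcoeff_msupp => h1 h2 ->; rewrite weightD.
have : (s <= weight A m2)%N by apply: (IH (fun k => h (lift ord0 k))) h2.
have /var_idealP/(_ _ h1)/exists_inP[i iA mi] := hA ord0.
suff : (0 < weight A m1)%N by lia.
by rewrite /weight (bigD1 i) //=; lia.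
Qed.

Lemma ideal_powS (I : S -> Prop) s g f :
  I g -> ideal_pow I s f -> ideal_pow I s.+1 (g * f).
Proof.
move=> Ig [r [c [h [hI ->]]]]; exists r, c, (fun k => g * h k); split=> [k|].
  have [t [tI ->]] := hI k; exists (fun j => oapp t g (unlift ord0 j)); split.
    by move=> j; case: unliftP => [j' _|_] /=; [apply: tI|apply: Ig].
  rewrite big_ord_recl unlift_none; congr (_ * _).
  by apply: eq_bigr => j _; rewrite liftK.
by rewrite mulr_sumr; apply: eq_bigr => k _; rewrite mulrCA.
Qed.

Lemma ideal_pow_varX A s m :
  (s <= weight A m)%N -> ideal_pow (var_ideal A) s ('X_[m] : S).
Proof.
elim: s m => [|s IH] m sm.
  rewrite -['X_[m]]mulr1; apply: ideal_genX; exists (fun=> 0); split=> [[]//|].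
  by rewrite big_ord0.
have /exists_inP[i iA mi] : [exists i in A, m i != 0%N].
  apply: contraTT sm; rewrite negb_exists_in => /forall_inP m0.
  by rewrite /weight big1 // => i /m0/negPn/eqP.
have Um : (U_(i) <= m)%MM.
  by apply/mnm_lepP => j; rewrite mnm1E; case: eqP => [<-|] //=; lia.
rewrite (mpolyX_sub Um) mulrC; apply: ideal_powS.
  by apply: ideal_gen_mem; exists i.
apply: IH; suff : weight A U_(i) = 1%N.
  by move: sm; rewrite -{1}(submK Um) weightD; lia.
rewrite /weight (bigD1 i) //= mnm1E eqxx big1 // => j /andP[_ ji].
by rewrite mnm1E eq_sym (negbTE ji).
Qed.

Lemma card_le_weight A m : (#|A :&: mset m| <= weight A m)%N.
Proof.
rewrite -sum1_card /weight (eq_bigl (fun i => (i \in A) && (m i != 0%N))).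
  by rewrite big_mkcondr; apply: leq_sum => i _; case: ifP; lia.
by move=> i; rewrite !inE.
Qed.

Lemma weight_le_card A m :
  squarefree_monomial m -> (weight A m <= #|A :&: mset m|)%N.
Proof.
move=> sq; rewrite -sum1_card (eq_bigl (fun i => (i \in A) && (m i != 0%N))).
  by rewrite big_mkcondr; apply: leq_sum => i _; have := sq i; case: ifP; lia.
by move=> i; rewrite !inE.
Qed.

Lemma edge_idealP f :
  edge_ideal K e f <->
  msupp_in (fun m => [exists i in mset m, exists j in mset m, e i j]) f.
Proof.
split.
  apply: ideal_gen_msupp.
    move=> m m' /exists_inP[i im /exists_inP[j jm ij]].
    apply/exists_inP; exists i; first by rewrite !inE mnmDE in im *; lia.
    by apply/exists_inP; exists j => //; rewrite !inE mnmDE in jm *; lia.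
  move=> g [i [j [ij ->]]] m; rewrite -mpolyXD mcoeffX.
  have [<- _|_] := eqVneq (U_(i) + U_(j))%MM m; last by rewrite eqxx.
  apply/exists_inP; exists i; first by rewrite inE mnmDE mnm1E eqxx.
  by apply/exists_inP; exists j; rewrite // inE mnmDE !mnm1E eqxx; lia.
apply: ideal_gen_monomials => m /exists_inP[i im /exists_inP[j jm ij]].
exists (U_(i) + U_(j))%MM.
  apply/mnm_lepP => k; rewrite mnmDE !mnm1E; rewrite !inE in im jm.
  have [E|_] := eqVneq i k; have [E'|_] := eqVneq j k; subst => //=; try lia.
  by rewrite e_irr in ij.
by exists i, j; split=> //; rewrite mpolyXD.
Qed.

Definition indicator A : 'X_{1..n} := [multinom (i \in A : nat) | i < n].

Lemma mset_indicator A : mset (indicator A) = A.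
Proof. by apply/setP => i; rewrite inE mnmE; case: (i \in A). Qed.

Lemma msupp_inX_eq (Q : pred 'X_{1..n}) m : msupp_in Q ('X_[m] : S) <-> Q m.
Proof.
split=> [/(_ m)|Qm m']; rewrite mcoeffX; first by rewrite eqxx oner_eq0; apply.
by have [<-|_] := eqVneq m m' => //; rewrite eqxx.
Qed.

Lemma vertex_coverP C x y : vertex_cover e C -> e x y -> (x \in C) || (y \in C).
Proof. by move=> /forallP/(_ x)/forallP/(_ y)/implyP. Qed.

Lemma decomposition_cover P A :
  decomposition (edge_ideal K e) P -> A \in P -> vertex_cover e A.
Proof.
move=> dP AP; apply/forallP => x; apply/forallP => y; apply/implyP => xy.
have /dP/(_ A AP)/var_idealP : edge_ideal K e 'X_[U_(x) + U_(y)].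
  by apply: ideal_gen_mem; exists x, y; rewrite mpolyXD.
move/msupp_inX_eq/exists_inP => [z zA]; rewrite mnmDE !mnm1E.
have [->|_] := eqVneq x z; first by rewrite zA.
by have [->|_] := eqVneq y z; rewrite ?zA ?orbT.
Qed.

(* Tested on the product of the variables outside C.                          *)
Lemma decomposition_sub P C :
  decomposition (edge_ideal K e) P -> vertex_cover e C ->
  exists2 A, A \in P & A \subset C.
Proof.
move=> dP coverC; apply/exists_inP; apply: contraT.
rewrite negb_exists_in => /forall_inP noA.
have : edge_ideal K e 'X_[indicator (~: C)].
  apply/dP => A AP; apply/var_idealP/msupp_inX_eq.
  have /subsetPn[i iA iC] := noA A AP; apply/exists_inP; exists i => //.
  by rewrite mnmE inE iC.
move/edge_idealP/msupp_inX_eq/exists_inP => [i].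
rewrite mset_indicator inE => iC /exists_inP[j]; rewrite inE => jC ij.
by have := vertex_coverP coverC ij; rewrite (negbTE iC) (negbTE jC).
Qed.

(** If the support of a monomial contains no edge, its complement is a vertex cover whose prime
    misses that monomial. *)
Lemma decomposition_covers :
  decomposition (edge_ideal K e) [set C | vertex_cover e C].
Proof.
move=> f; split=> [/edge_idealP If C|H].
  rewrite inE => coverC; apply/var_idealP; apply: msupp_inW If => m.
  case/exists_inP => i; rewrite inE => mi /exists_inP[j]; rewrite inE => mj ij.
  apply/exists_inP.
  by case/orP: (vertex_coverP coverC ij) => ?; [exists i|exists j].
apply/edge_idealP => m fm; apply: contraT => noedge.
have : ~: mset m \in [set C | vertex_cover e C].
  rewrite inE; apply/forallP => i; apply/forallP => j; apply/implyP => ij.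
  rewrite !in_setC -negb_and; apply: contra noedge => /andP[im jm].
  by apply/exists_inP; exists i => //; apply/exists_inP; exists j.
move/H/var_idealP/(_ _ fm)/exists_inP => [i]; rewrite !inE => /negPn/eqP ->.
by [].
Qed.

(** A decomposition with the fewest components is irredundant. *)
Lemma exists_irredundant :
  exists P, irredundant_decomposition (edge_ideal K e) P.
Proof.
have [|k [P [Pk dP]] kmin] := @ex_least (fun k => exists P : {set {set 'I_n}},
    #|P| = k /\ decomposition (edge_ideal K e) P).
  eexists; exists [set C | vertex_cover e C]; split=> //.
  exact: decomposition_covers.
exists P; split=> // A AP dPA.
have : (k <= #|P :\ A|)%N by apply: kmin; exists (P :\ A).
by rewrite -Pk (cardsD1 A P) AP add1n ltnn.
Qed.

(** For squarefree m, membership in the s-th power of a component means that the component meets the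
    support in at least s vertices. Components are vertex covers and every vertex cover contains
    one, so this can be tested on all vertex covers. *)
Lemma squarefree_symbolicP s f :
  squarefree_part (symbolic_power (edge_ideal K e) s) f <->
  msupp_in (fun m => cover_ge e s (mset m)) f.
Proof.
split.
  apply: ideal_gen_msupp => [m m'|_ [m [sqm -> [P [dP _] HP]]]].
    apply/implyP/cover_ge_mono/subsetP => i; rewrite !inE mnmDE; lia.
  apply/msupp_inX_eq; rewrite cover_ge_vertex_cover; apply/forall_inP => C coverC.
  have [A AP AC] := decomposition_sub dP coverC.
  have /msupp_inX_eq sA := ideal_pow_var_weight (HP A AP).
  apply: leq_trans sA _; apply: leq_trans (weight_le_card A sqm) _.
  by rewrite setIC subset_leq_card // setIS.
(* The generator dividing m is its radical, which has the same support. *)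
apply: ideal_gen_monomials => m Qm; exists (indicator (mset m)).
  by apply/mnm_lepP => i; rewrite mnmE inE; lia.
exists (indicator (mset m)); split=> //.
  by move=> i; rewrite mnmE; case: (_ \in _).
have [P dP] := exists_irredundant; exists P => // A AP; apply: ideal_pow_varX.
apply: leq_trans (card_le_weight _ _); rewrite mset_indicator setIC.
move: Qm; rewrite cover_ge_vertex_cover => /forall_inP; apply.
exact: decomposition_cover dP.1 AP.
Qed.

End SymbolicPower.

Theorem theorem4p3 (K : fieldType) (n : nat) (e : rel 'I_n)
    (e_sym : ssrbool.symmetric e) (e_irr : irreflexive e) (e_chordal : chordal e)
    (s : nat) (s_ge1 : (1 <= s)%N) (s_le_ht : (s <= edge_ideal_height e)%N)
    (r : int)
    (reg_r : is_regularity
               (squarefree_part (symbolic_power (edge_ideal K e) s)) r) :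
  (r <= (s + ord_match e)%N%:Z)%R.
Proof.
have [F [[i [j [bij ->]]] _]] := reg_r.
have := betti_reg_le (squarefree_symbolicP e_irr s)
  (@reg_le_cover K n e e_sym e_irr e_chordal s) bij.
lia.
Qed.
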